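(* Let $F$ be a Banach space. The following statements are equivalent. (a) $F$ has the Schur property. (b) $\mathcal{K}(E,F)=\mathcal{L}(E,F)$ for every reflexive Banach space $E$. (c) $\mathcal{W}_\infty(E,F)=\mathcal{L}(E,F)$ for every reflexive Banach space $E$. (d) $\mathcal{V}(E,F)=\mathcal{L}(E,F)$ for every reflexive Banach space $E$. (e) $\operatorname{NA}(E,F)=\mathcal{L}(E,F)$ for every reflexive Banach space $E$. (f) $\mathcal{K}(G,F)=\mathcal{L}(G,F)$ for every reflexive Banach space $G$ with a (Schauder) basis. (g) $\operatorname{NA}(G,F)=\mathcal{L}(G,F)$ for every reflexive Banach space $G$ with a (Schauder) basis. (h) $\mathcal{W}_\infty(G,F)=\mathcal{L}(G,F)$ for every reflexive Banach space $G$ with a (Schauder) basis. (i) $\mathcal{V}(G,F)=\mathcal{L}(G,F)$ for every reflexive Banach space $G$ with a (Schauder) basis.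
   Context: All Banach spaces are over a fixed field $\mathbb{K}$, which is either $\mathbb{R}$ or $\mathbb{C}$. $\mathcal{L}(E,F)$ is the space of all bounded linear operators from $E$ into $F$, and $\mathcal{K}(E,F)$ is the space of all compact operators from $E$ into $F$. $\operatorname{NA}(E,F)$ is the set of norm-attaining operators, i.e. those $T\in\mathcal{L}(E,F)$ for which there exists $x\in B_E$ (the closed unit ball of $E$) with $\|T(x)\|=\|T\|$. $\mathcal{V}(E,F)$ is the space of completely continuous operators, i.e. those $T\in\mathcal{L}(E,F)$ that send weakly null sequences in $E$ to norm null sequences in $F$. A subset $C$ of a Banach space $X$ is relatively weakly $\infty$-compact if there exists a weakly null sequence $(x_n)$ in $X$ such that $C\subset\{\sum_{n=1}^\infty a_n x_n : (a_n)\in B_{\ell_1}\}$. An operator $T\in\mathcal{L}(E,F)$ is weakly $\infty$-compact if $T(B_E)$ is a relatively weakly $\infty$-compact subset of $F$; $\mathcal{W}_\infty(E,F)$ is the space of all weakly $\infty$-compact operators from $E$ into $F$. A Banach space has the Schur property if every weakly convergent sequence in it is norm convergent. *)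

(* Defs.v *)
From HB Require Import structures.
From mathcomp Require Import all_boot all_order all_algebra.
From mathcomp Require Import complex.
From mathcomp Require Import all_classical all_reals all_analysis.

Set Implicit Arguments.
Unset Strict Implicit.
Unset Printing Implicit Defensive.

Import Order.TTheory GRing.Theory Num.Theory.
Import numFieldNormedType.Exports.

Local Open Scope classical_set_scope.
Local Open Scope ring_scope.

Inductive scalar_kind := RealScalars | ComplexScalars.

Definition scalar_field (R : realType) (k : scalar_kind) : numFieldType :=
  match k with
  | RealScalars => R
  | ComplexScalars => R[i]%C
  end.

(* The norm of a normed module over K takes its values in K.  In R[i] only
   elements with the same imaginary part are comparable, so a nonempty
   set of nonnegative elements has at most one supremum, and that supremum is real. *)
Lemma scalar_supremums_neq0 (R : realType) (k : scalar_kind)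
    (A : set (scalar_field R k)) (M : scalar_field R k) :
  A !=set0 -> (forall a, A a -> 0 <= a) -> ubound A M -> supremums A !=set0.
Proof.
case: k A M => /= A M A0 Age0 AM.
  have hA : has_sup A by split=> //; exists M.
  exists (sup A); split; first by apply/ubP; exact: sup_upper_bound.
  by move=> y Ay; apply: ge_sup.
have ImA a : A a -> complex.Im a = 0.
  by move=> /Age0; rewrite lecE => /andP[/eqP].
pose B := @complex.Re R @` A.
have AMp a : A a -> complex.Im M = 0 /\ complex.Re a <= complex.Re M.
  move=> Aa; have := AM _ Aa; rewrite lecE => /andP[/eqP MI ?].
  by split=> //; rewrite MI ImA.
have hB : has_sup B.
  split; first by case: A0 => a Aa; exists (complex.Re a), a.
  by exists (complex.Re M) => _ [a Aa <-]; exact: (AMp _ Aa).2.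
exists ((sup B)%:C)%C; split.
  move=> a Aa; rewrite lecE/= ImA// eqxx/=.
  by apply: sup_upper_bound => //; exists a.
move=> y Ay; have [a0 Aa0] := A0.
rewrite lecE/=; apply/andP; split.
  by have := Ay _ Aa0; rewrite lecE => /andP[/eqP -> _]; rewrite ImA.
apply: ge_sup; first by case: hB.
by move=> _ [a Aa <-]; have := Ay _ Aa; rewrite lecE => /andP[].
Qed.

Definition unit_ball (K : numFieldType) (E : normedModType K) : set E :=
  [set x | `|x| <= 1].
Arguments unit_ball {K} E.

Section bounded_operators.
Variables (R : realType) (k : scalar_kind).
Local Notation K := (scalar_field R k).
Variables E F : normedModType K.

Definition bounded_linear : {pred E -> F} :=
  mem [set T | linear T /\ exists M : K, forall x, `|T x| <= M * `|x|].

Lemma bounded_linear_submod_closed : submod_closed bounded_linear.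
Proof.
split.
  rewrite inE; split; first by move=> a x y; rewrite /= scaler0 addr0.
  by exists 0 => x; rewrite mul0r normr0.
move=> a S T; rewrite !inE => -[Sl [M SM]] [Tl [N TN]]; split.
  move=> b x y; rewrite !fctE/= Sl Tl !scalerDr !scalerA (mulrC a b).
  by rewrite addrACA.
exists (`|a| * M + N) => x; rewrite !fctE/=.
rewrite (le_trans (ler_normD _ _))// normrZ mulrDl lerD// -mulrA.
exact: ler_wpM2l.
Qed.

HB.instance Definition _ :=
  GRing.isSubmodClosed.Build K (E -> F) bounded_linear
    bounded_linear_submod_closed.

Record bounded_op := Bop {
  bop_fun :> E -> F;
  bop_prop : bop_fun \in bounded_linear }.

HB.instance Definition _ := [isSub for bop_fun].
HB.instance Definition _ := [Choice of bounded_op by <:].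
HB.instance Definition _ := [SubChoice_isSubLmodule of bounded_op by <:].

Definition opnorm (T : bounded_op) : K :=
  supremum 0 [set `|T x| | x in unit_ball E].

Lemma bop_linear (T : bounded_op) : linear T.
Proof. by have := bop_prop T; rewrite inE => -[]. Qed.

Lemma bop_bounded (T : bounded_op) : exists M : K, forall x, `|T x| <= M * `|x|.
Proof. by have := bop_prop T; rewrite inE => -[]. Qed.

Lemma bopZ (T : bounded_op) a x : T (a *: x) = a *: T x.
Proof.
have T0 : T 0 = 0.
  by have := bop_linear T (-1) 0 0; rewrite !scaleN1r oppr0 addr0 addNr.
by have := bop_linear T a x 0; rewrite T0 !addr0.
Qed.

Lemma opnorm_supremums (T : bounded_op) :
  supremums [set `|T x| | x in unit_ball E] (opnorm T).
Proof.
have [M TM] := bop_bounded T.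
have A0 : [set `|T x| | x in unit_ball E] !=set0.
  by exists `|T 0|, 0 => //; rewrite /unit_ball/= normr0.
have [s As] : supremums [set `|T x| | x in unit_ball E] !=set0.
  apply: (@scalar_supremums_neq0 _ _ _ `|M|) => //.
    by move=> _ [x _ <-].
  move=> _ [x x1 <-].
  have M0 : 0 <= M * `|x| by exact: le_trans (TM x).
  rewrite (le_trans (TM x))// -(ger0_norm M0) normrM normr_id.
  exact: ler_piMr.
rewrite /opnorm /supremum; case: ifPn => [/eqP A0'|_].
  by move: A0; rewrite A0' => -[].
by case: xgetP => [y _ //|/(_ s)].
Qed.

Lemma ler_opnorm_ball (T : bounded_op) x : `|x| <= 1 -> `|T x| <= opnorm T.
Proof. by move=> x1; have [ub _] := opnorm_supremums T; apply: ub; exists x. Qed.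

Lemma opnorm_le (T : bounded_op) M :
  (forall x, `|x| <= 1 -> `|T x| <= M) -> opnorm T <= M.
Proof.
move=> TM; have [_ lb] := opnorm_supremums T.
by apply: lb => _ [x x1 <-]; exact: TM.
Qed.

Lemma ler_opnormD (S T : bounded_op) : opnorm (S + T) <= opnorm S + opnorm T.
Proof.
apply: opnorm_le => x x1.
by rewrite (le_trans (ler_normD _ _))// lerD// ler_opnorm_ball.
Qed.

Lemma opnormZ (a : K) (T : bounded_op) : opnorm (a *: T) = `|a| * opnorm T.
Proof.
have leZ b S : opnorm (b *: S) <= `|b| * opnorm S.
  apply: opnorm_le => x x1.
  have -> : (b *: S) x = b *: S x by [].
  by rewrite normrZ ler_wpM2l// ler_opnorm_ball.
apply/eqP; rewrite eq_le leZ/=.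
have [->|a0] := eqVneq a 0.
  rewrite normr0 mul0r scale0r (le_trans (normr_ge0 ((0 : bounded_op) 0)))//.
  by apply: ler_opnorm_ball; rewrite normr0.
have := leZ a^-1 (a *: T).
by rewrite scalerA mulVf// scale1r normfV ler_pdivlMl// normr_gt0.
Qed.

Lemma opnorm0_eq0 (T : bounded_op) : opnorm T = 0 -> T = 0.
Proof.
move=> T0; apply/val_inj/funext => x /=.
have [->|x0] := eqVneq x 0; first by rewrite -(scale0r 0) bopZ scale0r.
have nx0 : `|x| != 0 by rewrite normr_eq0.
have /(ler_opnorm_ball T) : `| `|x|^-1 *: x | <= 1.
  by rewrite normrZ normfV normr_id mulVf.
rewrite T0 bopZ normr_le0 scaler_eq0 invr_eq0 (negbTE nx0)/=.
by move/eqP.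
Qed.

HB.instance Definition _ :=
  Lmodule_isNormed.Build K bounded_op ler_opnormD opnormZ opnorm0_eq0.

End bounded_operators.

Section classes.
Variables (R : realType) (k : scalar_kind).
Local Notation K := (scalar_field R k).

Definition dual (E : normedModType K) := bounded_op E K^o.

(* The canonical embedding into the bidual is onto. *)
Definition reflexive_space (E : normedModType K) :=
  forall phi : dual (dual E), exists x : E, forall f : dual E, phi f = f x.

Definition weakly_cvg (E : normedModType K) (x : E^nat) (l : E) :=
  forall f : dual E, f (x n) @[n --> \oo] --> f l.

Definition schur_property (E : normedModType K) :=
  forall (x : E^nat) (l : E), weakly_cvg x l -> cvgn x.

(* The basis is indexed by nat, so a space with a basis is infinite
   dimensional. *)
Definition schauder_basis (E : normedModType K) (e : E^nat) :=
  forall x : E, exists! a : K^nat, [series a n *: e n]_n @ \oo --> x.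

Definition has_schauder_basis (E : normedModType K) :=
  exists e : E^nat, schauder_basis e.

Definition l1_ball : set (K^nat) :=
  [set a : K^nat | let s : K^nat := series (fun n => `|a n| : K) in
     cvgn s /\ limn s <= 1].

Definition relatively_weakly_oo_compact (E : normedModType K) (C : set E) :=
  exists2 x : E^nat, weakly_cvg x 0 &
    C `<=` [set y | exists2 a, l1_ball a & [series a n *: x n]_n @ \oo --> y].

Definition compact_ops (E F : normedModType K) : set (bounded_op E F) :=
  [set T : bounded_op E F | precompact (T @` unit_ball E)].

Definition weakly_oo_compact_ops (E F : normedModType K) :
  set (bounded_op E F) :=
  [set T : bounded_op E F | relatively_weakly_oo_compact (T @` unit_ball E)].

Definition completely_continuous_ops (E F : normedModType K) :
  set (bounded_op E F) :=
  [set T : bounded_op E F | forall x : E^nat, weakly_cvg x 0 ->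
     T (x n) @[n --> \oo] --> (0 : F)].

Definition norm_attaining_ops (E F : normedModType K) : set (bounded_op E F) :=
  [set T : bounded_op E F | exists2 x, unit_ball E x & `|T x| = `|T|].

End classes.

Arguments compact_ops {R k} E F.
Arguments weakly_oo_compact_ops {R k} E F.
Arguments completely_continuous_ops {R k} E F.
Arguments norm_attaining_ops {R k} E F.

(* Main.v *)
Require Import Defs.
From HB Require Import structures.
From mathcomp Require Import all_boot all_order all_algebra.
From mathcomp Require Import complex.
From mathcomp Require Import all_classical all_reals all_analysis.
From mathcomp Require Import lra ring.

(* If F is Schur, every operator T : E -> F is completely continuous; on a
   reflexive E bounded sequences have weakly convergent subsequences, so T is
   compact and attains its norm. A compact set lies in {sum a_n x_n : |a|_1 <= 1}
   for a norm null (x_n), and weakly oo-compact operators are completely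
   continuous by a gliding hump argument, whatever the spaces.

   Conversely let (y_n) be weakly null in F with |y_n| = 1. The space G of scalar
   sequences is normed by the functionals
     a |-> sum_j c_j sum_(p_j <= n < q_j) a_n f_j(y_n),
   where sum |c_j|^2 <= 1, the intervals [p_j, q_j) are disjoint, f_j lies in the
   dual of F and |f_j| |f_j(y_n)| <= 1 on [p_j, q_j). The square-summable weights
   make the unit vector basis (e_n) boundedly complete; the bounds on f_j, which
   play the role of the Davis-Figiel-Johnson-Pelczynski interpolation, make it
   shrinking. So G is reflexive. The operator T e_n = (1 - 2^-(n+1)) y_n has
   |T a| < |a| for a <> 0 although |T e_n| tends to 1, and (e_n) is weakly null:
   T neither attains its norm nor is completely continuous. *)

Set Implicit Arguments.
Unset Strict Implicit.
Unset Printing Implicit Defensive.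

Import Order.TTheory GRing.Theory Num.Theory.
Import numFieldNormedType.Exports.

Local Open Scope classical_set_scope.
Local Open Scope ring_scope.

(** * Scalars and real-valued norms *)

(** The piece bounds |f| |f (y_n)| <= 1 act in two directions. A functional g on F is small at late
    y_n, so a large multiple of it is still a valid piece there; hence no g can stay away from 0 on
    the images of unit vectors supported far out, and by convexity some of these images are small in
    norm. Conversely, a piece with large |f| is small at each y_n of its interval, so it cannot be
    large on two blocks whose images in F decrease fast. Apart from at most three exceptional blocks
    per piece, values are then negligible: a sum of Q^2 normalized blocks has norm of order Q, and
    no functional stays above e > 0 on all of them.

    The weights of T are the partial sums of 2^-(i+1), so T averages the tail sums of sum a_n y_n.
    The tails of a tend to 0, and so the average is strictly below |a|.

    T has to refute norm attainment and complete continuity at once: norm attainment by all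
    operators gives compactness only by way of the Schur property. *)

Section scalars.
Variables (R : realType) (k : scalar_kind).
Local Notation K := (scalar_field R k).

Definition ofR : R -> K :=
  match k return R -> scalar_field R k with
  | RealScalars => id
  | ComplexScalars => fun r => (r%:C)%C
  end.

Definition toR : K -> R :=
  match k return scalar_field R k -> R with
  | RealScalars => id
  | ComplexScalars => @complex.Re R
  end.

Lemma ofRD a b : ofR (a + b) = ofR a + ofR b.
Proof. by rewrite /ofR; case: k => //=; rewrite rmorphD. Qed.

Lemma ofRN a : ofR (- a) = - ofR a.
Proof. by rewrite /ofR; case: k => //=; rewrite rmorphN. Qed.

Lemma ofRB a b : ofR (a - b) = ofR a - ofR b.
Proof. by rewrite ofRD ofRN. Qed.

Lemma ofRM a b : ofR (a * b) = ofR a * ofR b.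
Proof. by rewrite /ofR; case: k => //=; rewrite rmorphM. Qed.

Lemma ofR0 : ofR 0 = 0.
Proof. by rewrite /ofR; case: k. Qed.

Lemma ofR1 : ofR 1 = 1.
Proof. by rewrite /ofR; case: k. Qed.

Lemma toRD a b : toR (a + b) = toR a + toR b.
Proof. by move: a b; rewrite /toR; case: k => //= a b; rewrite raddfD. Qed.

Lemma toRN a : toR (- a) = - toR a.
Proof. by move: a; rewrite /toR; case: k => //= a; rewrite raddfN. Qed.

Lemma toRK : cancel ofR toR.
Proof. by rewrite /ofR /toR; case: k. Qed.

Lemma toRZ r z : toR (ofR r * z) = r * toR z.
Proof.
move: z; rewrite /ofR /toR; case: k => //= -[a b] /=.
by rewrite mul0r subr0.
Qed.

Lemma ler_ofR a b : (ofR a <= ofR b) = (a <= b).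
Proof. by rewrite /ofR; case: k => //=; rewrite lecR. Qed.

Lemma ltr_ofR a b : (ofR a < ofR b) = (a < b).
Proof. by rewrite /ofR; case: k => //=; rewrite ltcR. Qed.

Lemma toR0 : toR 0 = 0.
Proof. by rewrite -ofR0 toRK. Qed.

Lemma ofR_toR z : 0 <= z -> ofR (toR z) = z.
Proof.
move: z; rewrite /ofR /toR; case: k => //= -[a b] /=.
by rewrite lecE/= => /andP[/eqP -> _].
Qed.

Lemma toR_le_norm z : toR z <= toR `|z|.
Proof.
move: z; rewrite /toR; case: k => /= z; first exact: ler_norm.
case: z => a b /=; apply: (le_trans (ler_norm _)).
by rewrite -sqrtr_sqr ler_wsqrtr// lerDl sqr_ge0.
Qed.

Lemma norm_ofR r : `|ofR r| = ofR `|r|.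
Proof.
rewrite /ofR; case: k => //=.
have := @normc_def R (r%:C)%C; rewrite /= expr0n/= addr0 sqrtr_sqr.
exact.
Qed.

Lemma phase z : exists2 u : K, `|u| = 1 & u * z = `|z|.
Proof.
have [->|z0] := eqVneq z 0; first by exists 1; rewrite ?normr1// mulr0 normr0.
have nz0 : `|z| != 0 by rewrite normr_eq0.
exists (`|z| / z); first by rewrite normf_div normr_id divff.
by rewrite mulfVK.
Qed.

Lemma toR_gt0 z : 0 < z -> 0 < toR z.
Proof. by move=> z0; rewrite -ltr_ofR ofR0 ofR_toR// ltW. Qed.

Section nrm.
Variable E : normedModType K.
Implicit Types x y : E.

(** Norms are elements of K, which is only partially ordered over the complex numbers; their real
    values admit suprema, infima and real arithmetic. *)
Definition nrm x : R := toR `|x|.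

Lemma ofR_nrm x : ofR (nrm x) = `|x|.
Proof. by rewrite ofR_toR. Qed.

Lemma nrm_ge0 x : 0 <= nrm x.
Proof. by rewrite -ler_ofR ofR0 ofR_nrm. Qed.

Lemma nrmD x y : nrm (x + y) <= nrm x + nrm y.
Proof. by rewrite -ler_ofR ofRD !ofR_nrm ler_normD. Qed.

Lemma nrmN x : nrm (- x) = nrm x.
Proof. by rewrite /nrm normrN. Qed.

Lemma nrmB x y : nrm (x - y) <= nrm x + nrm y.
Proof. by rewrite -(nrmN y) nrmD. Qed.

Lemma nrmBC x y : nrm (x - y) = nrm (y - x).
Proof. by rewrite -nrmN opprB. Qed.

Lemma nrm0 : nrm 0 = 0.
Proof. by rewrite /nrm normr0 toR0. Qed.

Lemma nrm_eq0 x : nrm x = 0 -> x = 0.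
Proof. by move=> x0; apply/eqP; rewrite -normr_eq0 -ofR_nrm x0 ofR0. Qed.

Lemma nrm_gt0 x : x != 0 -> 0 < nrm x.
Proof.
move=> x0; rewrite lt_neqAle nrm_ge0 andbT eq_sym.
by apply: contra x0 => /eqP/nrm_eq0 ->.
Qed.

Lemma nrm_sum (I : Type) (r : seq I) (P : pred I) (x : I -> E) :
  nrm (\sum_(i <- r | P i) x i) <= \sum_(i <- r | P i) nrm (x i).
Proof.
elim/big_ind2 : _ => [|a b c d ab cd|//]; first by rewrite nrm0.
by rewrite (le_trans (nrmD _ _))// lerD.
Qed.

Lemma nrm_tri x y z : nrm (x - z) <= nrm (x - y) + nrm (y - z).
Proof. by have := nrmD (x - y) (y - z); rewrite addrA subrK. Qed.

Lemma ler_nrmB x y : nrm x - nrm y <= nrm (x - y).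
Proof. by have := nrmD (x - y) y; rewrite subrK lerBlDr. Qed.

End nrm.

Lemma nrmZ (E : normedModType K) (a : K^o) (x : E) : nrm (a *: x) = nrm a * nrm x.
Proof. by rewrite /nrm normrZ -{1}(ofR_toR (normr_ge0 a)) toRZ. Qed.

Lemma nrm_ofR r : nrm (ofR r : K^o) = `|r|.
Proof. by rewrite /nrm norm_ofR toRK. Qed.

Lemma nrmM (a b : K^o) : nrm (a * b : K^o) = nrm a * nrm b.
Proof. exact: nrmZ. Qed.

Lemma toR_le_nrm (z : K^o) : toR z <= nrm z.
Proof. exact: toR_le_norm. Qed.

Lemma rotation (z : K^o) : exists2 u : K^o, nrm u = 1 & u * z = ofR (nrm z).
Proof.
have [u u1 uz] := phase z; exists u; first by rewrite /nrm u1 -ofR1 toRK.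
by rewrite uz ofR_nrm.
Qed.

Definition rcvg (E : normedModType K) (u : nat -> E) (l : E) :=
  forall e : R, 0 < e -> exists N, forall n, (N <= n)%N -> nrm (u n - l) < e.

Lemma rcvgP (E : normedModType K) (u : nat -> E) (l : E) :
  u @ \oo --> l <-> rcvg u l.
Proof.
split.
  move=> /cvgrPdist_lt ul e e0.
  have := ul (ofR e); rewrite -ofR0 ltr_ofR => /(_ e0)[N _ NP].
  by exists N => n /NP /=; rewrite -ofR_nrm ltr_ofR nrmBC.
move=> ul; apply/cvgrPdist_lt => e e0; have [N NP] := ul _ (toR_gt0 e0).
exists N => // n /NP /=; rewrite nrmBC -ltr_ofR ofR_nrm ofR_toR//.
exact: ltW.
Qed.

Lemma rcvg_unique (E : normedModType K) (u : nat -> E) l m :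
  rcvg u l -> rcvg u m -> l = m.
Proof.
move=> ul um; apply/eqP; rewrite -subr_eq0; apply/negPn/negP => /nrm_gt0 lm.
have e0 : 0 < nrm (l - m) / 2 by lra.
have [N1 h1] := ul _ e0; have [N2 h2] := um _ e0.
have := nrm_tri l (u (maxn N1 N2)) m; rewrite (nrmBC l (u _)).
have := h1 _ (leq_maxl N1 N2); have := h2 _ (leq_maxr N1 N2); lra.
Qed.

Lemma rcvg_sub (E : normedModType K) (u : nat -> E) l (s : nat -> nat) :
  (forall n, (n <= s n)%N) -> rcvg u l -> rcvg (u \o s) l.
Proof.
move=> ns ul e /ul[N NP]; exists N => n Nn; apply: NP.
exact: leq_trans Nn (ns n).
Qed.

Lemma rcvg_bounded (E : normedModType K) (u : nat -> E) l :
  rcvg u l -> exists M, forall n, nrm (u n) <= M.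
Proof.
move=> /(_ 1 ltr01)[N NP].
exists (nrm l + 1 + \sum_(i < N) nrm (u i)) => n.
have [Nn|nN] := leqP N n.
  have := nrmD (u n - l) l; rewrite subrK => /le_trans; apply.
  have := NP _ Nn; have : 0 <= \sum_(i < N) nrm (u i).
    by apply: sumr_ge0 => i _; exact: nrm_ge0.
  lra.
rewrite (bigD1 (Ordinal nN))//=.
have : 0 <= \sum_(i < N | i != Ordinal nN) nrm (u i).
  by apply: sumr_ge0 => i _; exact: nrm_ge0.
have := nrm_ge0 l; lra.
Qed.

Section operators.
Variables E F : normedModType K.

Lemma bopD (T : bounded_op E F) x y : T (x + y) = T x + T y.
Proof. by have := bop_linear T 1 x y; rewrite !scale1r. Qed.

Lemma bopN (T : bounded_op E F) x : T (- x) = - T x.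
Proof. by rewrite -scaleN1r bopZ scaleN1r. Qed.

Lemma bopB (T : bounded_op E F) x y : T (x - y) = T x - T y.
Proof. by rewrite bopD bopN. Qed.

Lemma bop0 (T : bounded_op E F) : T 0 = 0.
Proof. by rewrite -(scale0r 0) bopZ scale0r. Qed.

Lemma bop_sum (T : bounded_op E F) (I : Type) (r : seq I) (P : pred I) (x : I -> E) :
  T (\sum_(i <- r | P i) x i) = \sum_(i <- r | P i) T (x i).
Proof.
elim/big_ind2 : _ => [|a b c d <- <-|//]; first by rewrite bop0.
by rewrite bopD.
Qed.

Lemma nrm_opP (T : bounded_op E F) x : nrm (T x) <= nrm T * nrm x.
Proof.
have [->|x0] := eqVneq x 0; first by rewrite bop0 !nrm0 mulr0.
have nx0 := nrm_gt0 x0.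
have := @ler_opnorm_ball _ _ _ _ T (ofR (nrm x)^-1 *: x).
rewrite bopZ -!ofR_nrm -ofR1 ler_ofR nrmZ nrm_ofR.
rewrite gtr0_norm ?invr_gt0// mulVf ?gt_eqF// lexx => /(_ isT).
rewrite nrmZ nrm_ofR gtr0_norm ?invr_gt0// -[opnorm T]/(`|T|) -ofR_nrm ler_ofR.
by rewrite mulrC ler_pdivrMr.
Qed.

Lemma nrm_op_le (T : bounded_op E F) M : 0 <= M ->
  (forall x, nrm (T x) <= M * nrm x) -> nrm T <= M.
Proof.
move=> M0 TM; rewrite -ler_ofR ofR_nrm; apply: opnorm_le => x.
rewrite -!ofR_nrm -ofR1 !ler_ofR => x1.
by rewrite (le_trans (TM x))// ler_piMr.
Qed.

Lemma nrm_op_sup (T : bounded_op E F) M :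
  (forall x, nrm x <= 1 -> nrm (T x) <= M) -> nrm T <= M.
Proof.
move=> TM; rewrite -ler_ofR ofR_nrm; apply: opnorm_le => x.
by rewrite -!ofR_nrm -ofR1 !ler_ofR => /TM.
Qed.

Lemma make_op (f : E -> F) (M : R) : linear f ->
  (forall x, nrm (f x) <= M * nrm x) -> exists T : bounded_op E F, T =1 f.
Proof.
move=> lf fM.
suff H : f \in @bounded_linear R k E F by exists (Bop H).
rewrite inE; split => //; exists (ofR M) => x.
by rewrite -!ofR_nrm -ofRM ler_ofR.
Qed.

End operators.

Lemma comp_dual (E F : normedModType K) (T : bounded_op E F) (f : dual F) :
  exists g : dual E, forall x, g x = f (T x).
Proof.
have [|x|g ge] := @make_op E K^o (f \o T) (nrm f * nrm T); last by exists g.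
  by move=> a x y /=; rewrite bopD bopZ bopD bopZ.
by rewrite /= (le_trans (nrm_opP _ _))// -mulrA ler_wpM2l ?nrm_ge0// nrm_opP.
Qed.

Definition wnull (E : normedModType K) (x : nat -> E) :=
  forall f : dual E, rcvg (f \o x) 0.

Lemma weakly_cvgP (E : normedModType K) (x : nat -> E) l :
  weakly_cvg x l <-> wnull (fun n => x n - l).
Proof.
split=> xl f.
  move=> e; have /rcvgP/(_ e) := xl f => /[apply]-[N NP]; exists N => n /NP /=.
  by rewrite subr0 bopB.
apply/rcvgP => e; have /(_ e) := xl f => /[apply]-[N NP]; exists N => n /NP /=.
by rewrite subr0 bopB.
Qed.

Lemma weakly_null (E : normedModType K) (x : nat -> E) :
  weakly_cvg x 0 <-> wnull x.
Proof.
rewrite weakly_cvgP; have -> // : (fun n => x n - 0) = x.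
by apply/funext => n; rewrite subr0.
Qed.

Lemma wnull_sub (E : normedModType K) (x : nat -> E) (s : nat -> nat) :
  (forall n, (n <= s n)%N) -> wnull x -> wnull (x \o s).
Proof. by move=> ns wx f; apply: (rcvg_sub ns (wx f)). Qed.

Lemma wnull_op (E F : normedModType K) (T : bounded_op E F) x :
  wnull x -> wnull (T \o x).
Proof.
move=> wx f; have [g gE] := comp_dual T f => e /(wx g)[N NP].
by exists N => n /NP; rewrite /= gE.
Qed.

End scalars.

Lemma increasing_ge (s : nat -> nat) :
  (forall n, (s n < s n.+1)%N) -> forall n, (n <= s n)%N.
Proof. by move=> si; elim=> // n IH; exact: leq_ltn_trans IH (si n). Qed.

(** For gliding humps and separated sequences, where each term is chosen against all the earlier
    ones. *)
Lemma dependent_sequence (T : Type) (P : seq T -> T -> Prop) :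
  (forall s, exists x, P s x) -> exists f : nat -> T, forall n, P (mkseq f n) (f n).
Proof.
move=> /choice[g gP].
pose st := fix st n := if n is m.+1 then rcons (st m) (g (st m)) else [::].
exists (fun n => g (st n)) => n.
suff -> : mkseq (fun n => g (st n)) n = st n by exact: gP.
by elim: n => //= n IH; rewrite mkseqS IH.
Qed.

Lemma infinite_subsequence (P : nat -> Prop) :
  (forall N, exists2 n, (N <= n)%N & P n) ->
  exists2 s : nat -> nat, (forall n, (s n < s n.+1)%N) & forall n, P (s n).
Proof.
move=> PN; have /choice[g gP] : forall N, exists n, (N <= n)%N /\ P n.
  by move=> N; have [n Nn Pn] := PN N; exists n.
pose s := fix s n := if n is m.+1 then g (s m).+1 else g 0.
exists s => [n|[|n]] /=; [|exact: (gP 0).2|exact: (gP _).2].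
exact: (gP _).1.
Qed.

(** * The Hahn-Banach theorem *)

Section hahn_banach.
Variables (R : realType) (k : scalar_kind).
Local Notation K := (scalar_field R k).
Variable E : normedModType K.
Implicit Types (p q : E -> R) (D : set (R * E)).

Definition sublinear p :=
  (forall x y, p (x + y) <= p x + p y) /\
  (forall t x, 0 <= t -> p (ofR k t *: x) = t * p x).

(** A pair (r, v) stands for the constraint r <= f v on the functional f to be found. *)
Definition convex_cone D :=
  [/\ D (0, 0), (forall a b, D a -> D b -> D (a.1 + b.1, a.2 + b.2))
    & forall t a, 0 <= t -> D a -> D (t * a.1, ofR k t *: a.2)].

Lemma sublinear0 p : sublinear p -> p 0 = 0.
Proof. by move=> [_ /(_ 0 0 (lexx _))]; rewrite mul0r scaler0. Qed.

Lemma sublinearN p x : sublinear p -> - p (- x) <= p x.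
Proof.
move=> sp; have := sp.1 x (- x); rewrite subrr (sublinear0 sp).
by rewrite -lerBlDr sub0r.
Qed.

(* The largest sublinear functional [q <= p] with [q (- v) <= - w] on [D]. *)
Lemma sublinear_lower p D : sublinear p -> convex_cone D ->
  (forall a, D a -> a.1 <= p a.2) ->
  exists q, [/\ sublinear q, (forall x, q x <= p x) &
    forall a, D a -> q (- a.2) <= - a.1].
Proof.
move=> sp [D0 DD DZ] Dp.
(* A linear f <= p with a.1 <= f a.2 on D satisfies f x = f (x + a.2) - f a.2 <= p (x + a.2) - a.1;
   q x is the infimum of these bounds. *)
pose S x := [set p (x + a.2) - a.1 | a in D].
have S0 x : S x !=set0 by exists (p (x + 0) - 0), (0, 0).
have Slb x : lbound (S x) (- p (- x)).
  move=> _ [a Da <-]; have := Dp _ Da; have := sp.1 (- x) (x + a.2).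
  rewrite addKr; lra.
have Si x : has_inf (S x) by split; [exact: S0|exists (- p (- x)); exact: Slb].
pose q x := inf (S x).
have ql x a : D a -> q x <= p (x + a.2) - a.1.
  by move=> Da; apply: ge_inf; [case: (Si x)|exists a].
have qg x m : (forall a, D a -> m <= p (x + a.2) - a.1) -> m <= q x.
  by move=> h; apply: lb_le_inf => // _ [a Da <-]; exact: h.
have qp x : q x <= p x by have := ql x _ D0; rewrite addr0 subr0.
have qZ t x : 0 < t -> q (ofR k t *: x) <= t * q x.
  move=> t0; rewrite mulrC -ler_pdivrMr//; apply: (qg) => a Da.
  rewrite ler_pdivrMr//; have := ql (ofR k t *: x) _ (DZ _ _ (ltW t0) Da).
  by rewrite /= -scalerDr (sp.2 _ _ (ltW t0)) (mulrC _ t) mulrBr.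
exists q; split => //.
- split=> [x y|t x].
    rewrite -lerBlDr; apply: (qg) => a Da.
    suff : q (x + y) - (p (x + a.2) - a.1) <= q y by lra.
    apply: (qg) => b Db; have := ql (x + y) _ (DD _ _ Da Db) => /=.
    have := sp.1 (x + a.2) (y + b.2); rewrite addrACA; lra.
  rewrite le_eqVlt => /predU1P[<-|t0].
    rewrite ofR0 scale0r mul0r; apply/eqP; rewrite eq_le; apply/andP; split.
      by rewrite -(sublinear0 sp).
    by apply: (qg) => a Da; rewrite add0r subr_ge0; exact: Dp.
  apply/eqP; rewrite eq_le qZ//= -ler_pdivlMl// mulrC mulrC.
  have := qZ t^-1 (ofR k t *: x); rewrite invr_gt0 => /(_ t0).
  by rewrite scalerA -ofRM mulVf ?gt_eqF// ofR1 scale1r.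
- move=> a Da; have := ql (- a.2) _ Da.
  by rewrite addNr (sublinear0 sp) sub0r.
Qed.

Definition real_linear p := sublinear p /\ forall x, p (- x) = - p x.

Lemma real_linearD p x y : real_linear p -> p (x + y) = p x + p y.
Proof.
move=> [sp pN]; apply/eqP; rewrite eq_le sp.1/=.
have := sp.1 (x + y) (- y); rewrite addrK pN; lra.
Qed.

Lemma real_linearZ p t x : real_linear p -> p (ofR k t *: x) = t * p x.
Proof.
move=> [sp pN]; have [t0|t0] := leP 0 t; first exact: sp.2.
rewrite -(opprK t) ofRN scaleNr pN sp.2 ?mulNr// oppr_ge0 ltW//.
Qed.

(* A minimal sublinear functional is linear, and Zorn's lemma provides one. *)
Lemma hahn_banach_real p : sublinear p ->
  exists2 f, real_linear f & forall x, f x <= p x.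
Proof.
move=> sp.
pose P q := sublinear q /\ forall x, q x <= p x.
pose T := {q | P q}.
(* The order is reversed: a Zorn-maximal element is a minimal sublinear functional. *)
pose le_ (a b : T) := `[< forall x, sval b x <= sval a x >].
have [||a b|A totA|[f [sf fp]] fmax] := @Zorn T le_.
- by move=> a; apply/asboolP.
- by move=> a b c /asboolP ab /asboolP bc; apply/asboolP => x;
  exact: le_trans (bc x) (ab x).
- case: a b => [a ap] [b bp] /asboolP/= ab /asboolP/= ba.
  by apply: eq_exist; apply/funext => x; apply/eqP; rewrite eq_le ba ab.
- have [->|/set0P A0] := eqVneq A set0;
  first by exists (exist P p (conj sp (fun=> lexx _))).
  pose S x := [set sval a x | a in A].
  have S0 x : S x !=set0 by have [a Aa] := A0; exists (sval a x), a.
  have Slb x : lbound (S x) (- p (- x)).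
    move=> _ [[q [sq qp]] /= Aa <-]; have := sublinearN x sq; have := qp (- x); lra.
  have ql x a : A a -> inf (S x) <= sval a x.
    by move=> Aa; apply: ge_inf; [exists (- p (- x)); exact: Slb|exists a].
  have qg x m : (forall a, A a -> m <= sval a x) -> m <= inf (S x).
    by move=> h; apply: lb_le_inf => // _ [a Aa <-]; exact: h.
  have sq : sublinear (fun x => inf (S x)).
    split=> [x y|t x].
      rewrite -lerBlDr; apply: (qg) => a Aa.
      suff : inf (S (x + y)) - sval a x <= inf (S y) by lra.
      (* Of two members of the chain, the smaller one can be used for both terms. *)
      apply: (qg) => b Ab; have [/asboolP ab|/asboolP ba] := totA _ _ Aa Ab.
        have := ql (x + y) _ Ab; have [[+ _] _] := svalP b => /(_ x y).
        have := ab x; lra.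
      have := ql (x + y) _ Aa; have [[+ _] _] := svalP a => /(_ x y).
      have := ba y; lra.
    move=> t0; apply/eqP; rewrite eq_le; apply/andP; split.
      have /predU1P[<-|{}t0] : (0 == t) || (0 < t) by rewrite -le_eqVlt.
        rewrite mul0r ofR0 scale0r; have [a Aa] := A0; have := ql 0 _ Aa.
        by have [sa _] := svalP a; rewrite (sublinear0 sa).
      rewrite mulrC -ler_pdivrMr//; apply: (qg) => a Aa; rewrite ler_pdivrMr//.
      have [[_ aZ] _] := svalP a; have := ql (ofR k t *: x) _ Aa.
      by rewrite (aZ _ _ (ltW t0)) mulrC.
    apply: (qg) => a Aa; have [[_ aZ] _] := svalP a; rewrite aZ// ler_wpM2l//.
    exact: ql.
  have qp x : inf (S x) <= p x.
    have [a Aa] := A0; apply: le_trans (ql _ _ Aa) _.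
    by have [_] := svalP a.
  by exists (exist P _ (conj sq qp)) => a Aa; apply/asboolP => x; exact: ql.
exists f => //; split=> // x0.
(* Lowering f along the ray of (f x0, x0) gives f again by minimality, and the bound on that ray
   reads f (- x0) <= - f x0. *)
pose D := [set (t * f x0, ofR k t *: x0) | t in [set t | 0 <= t]].
have DC : convex_cone D.
  split.
  - by exists 0 => //=; rewrite mul0r ofR0 scale0r.
  - move=> _ _ [s /= s0 <-] [t /= t0 <-]; exists (s + t); first exact: addr_ge0.
    by rewrite mulrDl ofRD scalerDl.
  - move=> s _ s0 [t /= t0 <-]; exists (s * t); first exact: mulr_ge0.
    by rewrite mulrA ofRM scalerA.
have [_ [t /= t0 <-]|q [sq qf qD]] := sublinear_lower sf DC.
  by rewrite /= sf.2.
have qp x : q x <= p x := le_trans (qf x) (fp x).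
have /(congr1 sval)/= qE : exist P q (conj sq qp) = exist P f (conj sf fp) :> T.
  by apply: fmax; apply/asboolP.
have := qD (f x0, x0); rewrite /= qE => fx.
apply/eqP; rewrite eq_le fx/=; last first.
  by exists 1 => //=; rewrite mul1r ofR1 scale1r.
by rewrite lerNl; have := sublinearN (- x0) sf; rewrite opprK => ?; lra.
Qed.

End hahn_banach.

(** A complex-linear g satisfies Im (g x) = - Re (g (i x)), so its real part f determines it: g x =
    f x - i f (i x). *)
Lemma complexify_linear (R : realType) (k : scalar_kind)
    (E : normedModType (scalar_field R k)) (f : E -> R) : real_linear f ->
  exists2 g : E -> (scalar_field R k)^o, linear g & forall x, toR (g x) = f x.
Proof.
case: k E f => E f lf.
  exists f => // a x y.
  by rewrite (real_linearD _ _ lf); congr (_ + _); exact: (real_linearZ a x lf).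
pose K := scalar_field R ComplexScalars; pose i : K := ('i)%C.
pose c : R -> K := ofR ComplexScalars.
have fZ (b : K) (z : E) :
    f (b *: z) = complex.Re b * f z + complex.Im b * f (i *: z).
  have bE : b = c (complex.Re b) + c (complex.Im b) * i.
    by case: b => b d; rewrite /i /c /ofR /=; simpc.
  rewrite {1}bE scalerDl -scalerA (real_linearD _ _ lf).
  by rewrite !(real_linearZ _ _ lf).
exists (fun x => c (f x) - i * c (f (i *: x))) => [a x y|x]; last first.
  by rewrite /= /c /ofR /i /=; lra.
rewrite scalerDr !(real_linearD _ _ lf) scalerA (fZ a x) (fZ (i * a) x).
by case: a => a b; rewrite /c /ofR /i /=; simpc; congr Complex; rewrite /=; ring.
Qed.

Section hahn_banach_dual.
Variables (R : realType) (k : scalar_kind).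
Local Notation K := (scalar_field R k).
Variable E : normedModType K.
Implicit Types (f : E -> R) (D : set (R * E)).

(** Multiplying x by a phase makes g x real and nonnegative without changing |x|, so the bound on
    the real part f is a bound on |g x|. *)
Lemma complexify f : real_linear f -> (forall x, f x <= nrm x) ->
  exists2 g : dual E, (forall x, nrm (g x) <= nrm x) & forall x, toR (g x) = f x.
Proof.
move=> lf fn.
have [g gl gf] := complexify_linear lf.
have gn x : nrm (g x) <= nrm x.
  have [u u1 ug] := rotation (g x).
  have <- : toR (g (u *: x)) = nrm (g x).
    have g0 : g 0 = 0.
      by apply: (addrI (g 0)); have := gl 1 0 0; rewrite !scale1r !addr0.
    by have := gl u x 0; rewrite !addr0 g0 addr0 => ->;
      rewrite -[u *: g x]/(u * g x) ug toRK.
  by rewrite gf (le_trans (fn _))// nrmZ u1 mul1r.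
have [x|h hg] := @make_op _ _ E K^o g 1 gl; first by rewrite mul1r.
by exists h => x; rewrite hg.
Qed.

Lemma nrm_sublinear : sublinear (@nrm R k E).
Proof.
split; first exact: nrmD.
by move=> t x t0; rewrite nrmZ nrm_ofR ger0_norm.
Qed.

Lemma hahn_banach_cone D : convex_cone D -> (forall a, D a -> a.1 <= nrm a.2) ->
  exists2 g : dual E, (forall x, nrm (g x) <= nrm x) &
    forall a, D a -> a.1 <= toR (g a.2).
Proof.
move=> DC Dn; have [q [sq qn qD]] := sublinear_lower nrm_sublinear DC Dn.
have [f lf fq] := hahn_banach_real sq.
have [|g gn gf] := complexify lf; first by move=> x; exact: le_trans (qn x).
exists g => // a Da; rewrite gf; have := le_trans (fq _) (qD _ Da).
by rewrite lf.2; lra.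
Qed.

Definition rconvex (C : set E) := forall x y s t, C x -> C y ->
  0 <= s -> 0 <= t -> s + t = 1 -> C (ofR k s *: x + ofR k t *: y).

(** Hahn-Banach for the cone generated by the pairs (e, x) with x in C: the bound required there is
    t e <= |t x|. *)
Lemma mazur (C : set E) e : rconvex C -> (forall x, C x -> e <= nrm x) ->
  exists2 g : dual E, (forall x, nrm (g x) <= nrm x) &
    forall x, C x -> e <= toR (g x).
Proof.
move=> Cc Ce.
(* Over an empty C the cone below would be empty and miss (0, 0). *)
have [->|/set0P[c0 Cc0]] := eqVneq C set0.
  have [||g] := @hahn_banach_cone [set (0, 0)]; last by exists g.
    by split=> [//|_ _ -> ->|t _ _ ->] /=; rewrite ?addr0// mulr0 scaler0.
  by move=> _ -> /=; rewrite nrm0.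
pose D := [set (a.1 * e, ofR k a.1 *: a.2) | a in [set a | 0 <= a.1 /\ C a.2]].
have [| |g gn gD] := @hahn_banach_cone D.
- split.
  + by exists (0, c0) => //=; rewrite mul0r ofR0 scale0r.
  + move=> _ _ [[s x] /= [s0 Cx] <-] [[t y] /= [t0 Cy] <-] /=.
    have [st|st] := eqVneq (s + t) 0.
      have [-> ->] : s = 0 /\ t = 0 by split; lra.
      by exists (0, x) => //=; rewrite !mul0r ofR0 !scale0r !addr0.
    exists (s + t, ofR k (s / (s + t)) *: x + ofR k (t / (s + t)) *: y) => /=.
      split; first exact: addr_ge0.
      by apply: Cc; rewrite ?divr_ge0 ?addr_ge0// -mulrDl divff.
    rewrite mulrDl scalerDr !scalerA -!ofRM;
      congr (_, ofR k _ *: _ + ofR k _ *: _); field.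
      exact: st.
    exact: st.
  + move=> t _ t0 [[s x] /= [s0 Cx] <-]; exists (t * s, x) => /=.
      by split=> //; exact: mulr_ge0.
    by rewrite mulrA scalerA ofRM.
- move=> _ [[t x] /= [t0 Cx] <-] /=.
  by rewrite nrmZ nrm_ofR ger0_norm// ler_wpM2l// Ce.
exists g => // x Cx; have := gD (e, x); apply.
by exists (1, x) => //=; rewrite mul1r ofR1 scale1r.
Qed.

Lemma norming (x : E) : exists2 g : dual E, (forall y, nrm (g y) <= nrm y) &
  nrm (g x) = nrm x.
Proof.
have [||g gn gx] := @mazur [set x] (nrm x).
- by move=> _ _ s t -> -> _ _ st; rewrite -scalerDl -ofRD st ofR1 scale1r.
- by move=> _ ->.
exists g => //; apply/eqP; rewrite eq_le gn (le_trans (gx x erefl))//.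
exact: toR_le_nrm.
Qed.

Lemma dual_separates (x : E) : (forall f : dual E, f x = 0) -> x = 0.
Proof.
by move=> x0; have [g _ gx] := norming x; apply: nrm_eq0; rewrite -gx x0 nrm0.
Qed.

End hahn_banach_dual.

(** * Weak cluster points and weak compactness *)

Section clusters.
Variables (R : realType) (k : scalar_kind).
Local Notation K := (scalar_field R k).

(** Lets real and complex scalars be treated alike: j is i over the complex numbers, while im and j
    are 0 over the reals. *)
Lemma scalar_coordinates : exists (im : K -> R) (j : K^o),
  [/\ nrm j <= 1, (forall z, `|im z| <= nrm (z : K^o)) &
      forall z, z = ofR k (toR z) + ofR k (im z) * j].
Proof.
rewrite /nrm /ofR /toR; case: k => /=.
  by exists (fun=> 0), 0; split=> [|z|z]; rewrite ?normr0// mulr0 addr0.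
exists (@complex.Im R), ('i)%C; split=> [|[a b]|[a b]] /=.
- by rewrite expr0n expr1n/= add0r sqrtr1.
- by rewrite -sqrtr_sqr ler_wsqrtr// lerDr sqr_ge0.
- by simpc.
Qed.

Lemma norm_toR_le (z : K^o) : `|toR z| <= nrm z.
Proof.
rewrite ler_norml toR_le_nrm andbT lerNl -toRN (le_trans (toR_le_nrm _))//.
by rewrite nrmN.
Qed.

Section ultralimit.
Variable U : set_system nat.
Hypothesis Uultra : UltraFilter U.

(** The limit is the supremum of the thresholds t with t <= u n for U-almost all n. *)
Lemma real_ultralimit (u : nat -> R) M : (forall n, `|u n| <= M) ->
  exists l, forall e, 0 < e -> U [set n | `|u n - l| < e].
Proof.
move=> uM; pose A := [set t | U [set n | t <= u n]].
have uM2 n : - M <= u n <= M by rewrite -ler_norml.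
have As : has_sup A.
  split.
    exists (- M); rewrite /A /=; apply: (@filterS _ U _ setT); last exact: filterT.
    by move=> n _ /=; case/andP: (uM2 n).
  by exists M => t /= At; have [n tn] := filter_ex At; case/andP: (uM2 n) => _;
    exact: le_trans.
exists (sup A) => e e0.
have [t At lt_t] := sup_adherent e0 As.
have : ~ A (sup A + e / 2) by move=> /(sup_upper_bound As); lra.
have [//|h _] := @in_ultra_setVsetC _ U [set n | sup A + e / 2 <= u n] _.
have At' : U [set n | t <= u n] by [].
apply: filterS (filterI At' h) => n /= [tn /negP]; rewrite -ltNge => nl.
rewrite ltr_norml; apply/andP; split; lra.
Qed.

Lemma scalar_ultralimit (u : nat -> K^o) M : (forall n, nrm (u n) <= M) ->
  exists l : K^o, forall e, 0 < e -> U [set n | nrm (u n - l) < e].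
Proof.
move=> uM; have [im [j [j1 imz zE]]] := scalar_coordinates.
have [a ua] :=
  @real_ultralimit (fun n => toR (u n)) M (fun n => le_trans (norm_toR_le _) (uM n)).
have [b ub] :=
  @real_ultralimit (fun n => im (u n)) M (fun n => le_trans (imz _) (uM n)).
exists (ofR k a + ofR k b * j) => e e0.
have e20 : 0 < e / 2 by lra.
apply: filterS (filterI (ua _ e20) (ub _ e20)) => n /= [h1 h2].
have -> : u n - (ofR k a + ofR k b * j) =
    ofR k (toR (u n) - a) + ofR k (im (u n) - b) * j :> K^o.
  by rewrite {1}(zE (u n)) !ofRB mulrBl opprD addrACA.
rewrite (le_lt_trans (nrmD _ _))// nrmM !nrm_ofR.
have : `|im (u n) - b| * nrm j <= `|im (u n) - b| * 1 by rewrite ler_wpM2l.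
by rewrite mulr1; lra.
Qed.

End ultralimit.

(** Weak* compactness in sequential use: psi is the pointwise limit along a free ultrafilter. Its
    sets meet every tail and are closed under finite intersections, whence the approximation at
    finitely many points by one arbitrarily late n. *)
Lemma cluster_functional (E : normedModType K) (phi : nat -> E -> K^o) C :
  (forall n, linear (phi n)) ->
  (forall n x, nrm (phi n x) <= C * nrm x) ->
  exists2 psi : dual E, (forall x, nrm (psi x) <= C * nrm x) &
    forall (s : seq E) e N, 0 < e ->
      exists2 n, (N <= n)%N & forall x, x \in s -> nrm (phi n x - psi x) < e.
Proof.
move=> lin_phi phiC.
have [U [Uu sU]] := ultraFilterLemma eventually_filter.
have /choice[psi psiP] : forall x, exists l : K^o, forall e, 0 < e ->
    U [set n | nrm (phi n x - l) < e].
  by move=> x; apply: scalar_ultralimit => n; exact: phiC.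
have psiC x : nrm (psi x) <= C * nrm x.
  apply/ler_addgt0Pr => e e0; have [n /= h] := filter_ex (psiP x e e0).
  have := nrmD (psi x - phi n x) (phi n x); rewrite subrK nrmBC.
  have := phiC n x; lra.
have lpsi : linear psi.
  move=> a x y; apply/eqP; rewrite -subr_eq0; apply/eqP/nrm_eq0/eqP.
  rewrite eq_le nrm_ge0 andbT; apply/ler_addgt0Pr => e e0; rewrite add0r.
  (* Three errors of size e / A, with weights 1, |a| and 1, add up to e. *)
  pose A := nrm (a : K^o) + 2; have A0 : 0 < A by have := nrm_ge0 (a : K^o);
    rewrite /A; lra.
  have eA : 0 < e / A by exact: divr_gt0.
  have [n /= [[h1 h2] h3]] :=
    filter_ex (filterI (filterI (psiP x _ eA) (psiP y _ eA)) (psiP (a *: x + y) _ eA)).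
  have -> : psi (a *: x + y) - (a *: psi x + psi y) =
      (psi (a *: x + y) - phi n (a *: x + y)) + (a *: (phi n x - psi x) + (phi n y - psi y)).
    rewrite (lin_phi n a x y) scalerBr [a *: _ - _ + _]addrACA -opprD.
    by rewrite addrA subrK.
  have -> : e = A * (e / A) by rewrite mulrCA divff ?mulr1// gt_eqF.
  have := nrmD (psi (a *: x + y) - phi n (a *: x + y)) (a *: (phi n x - psi x) + (phi n y - psi y)).
  have := nrmD (a *: (phi n x - psi x)) (phi n y - psi y).
  rewrite nrmZ (nrmBC (psi _) (phi n _)).
  have -> : A * (e / A) = nrm (a : K^o) * (e / A) + 2 * (e / A) by rewrite -mulrDl.
  have : nrm (a : K^o) * nrm (phi n x - psi x) <= nrm (a : K^o) * (e / A).
    by apply: ler_wpM2l; [exact: nrm_ge0|exact: ltW].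
  by lra.
have [psi' psiE] := make_op lpsi psiC.
exists psi' => [x|s e N e0]; first by rewrite psiE.
have h : U [set n | forall x, x \in s -> nrm (phi n x - psi' x) < e].
  elim: s => [|x s IH]; first by apply: filterS (filterT) => n _ x; rewrite inE.
  apply: filterS (filterI (psiP x e e0) IH) => n /= [hx hs] y.
  by rewrite inE => /predU1P[->|/hs//]; rewrite psiE.
have hN : U [set n | (N <= n)%N] by apply: sU; exists N.
by have [n /= [h1 h2]] := filter_ex (filterI h hN); exists n.
Qed.

(** A Cauchy sequence converges to any of its cluster points, and one is the value at 1 of a cluster
    functional of the maps x |-> x u_n. Starting at N1 makes these maps uniformly bounded. *)
Lemma scalar_complete (u : nat -> K^o) :
  (forall e, 0 < e -> exists N, forall m n, (N <= m)%N -> (N <= n)%N ->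
     nrm (u m - u n) < e) ->
  exists l, rcvg u l.
Proof.
move=> uC.
have [N1 hN1] := uC 1 ltr01.
have [||psi psiC psiP] := @cluster_functional K^o (fun n x => x * u (N1 + n)%N)
    (nrm (u N1) + 1).
- by move=> n a x y; rewrite mulrDl -[a *: x]/(a * x) -[RHS]/(a * _ + _) mulrA.
- move=> n x; rewrite nrmM mulrC ler_wpM2r ?nrm_ge0//.
  have := hN1 (N1 + n)%N N1 (leq_addr _ _) (leqnn _).
  have := nrmD (u (N1 + n)%N - u N1) (u N1); rewrite subrK; lra.
exists (psi 1) => e e0; have e2 : 0 < e / 2 by lra.
have [N hN] := uC _ e2; exists N => m Nm.
have [n Nn /(_ 1)] := psiP [:: 1] _ N e2.
rewrite mem_head mul1r => /(_ isT) h.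
have := nrm_tri (u m) (u (N1 + n)%N) (psi 1).
have := hN m (N1 + n)%N Nm (leq_trans Nn (leq_addl _ _)); lra.
Qed.

End clusters.

Lemma diagonal_subsequence (P : nat -> nat -> Prop) :
  (forall i N, exists2 n, (N <= n)%N & P i n) ->
  exists2 s : nat -> nat, (forall n, (s n < s n.+1)%N) & forall n, P n (s n).
Proof.
move=> PN; have /choice[g gP] : forall iN : nat * nat, exists n, (iN.2 <=
  n)%N /\ P iN.1 n.
  by move=> [i N]; have [n Nn Pn] := PN i N; exists n.
pose s := fix s n := if n is m.+1 then g (n, (s m).+1) else g (0, 0).
exists s => [n|[|n]] /=; [|exact: (gP (_, _)).2|exact: (gP (_, _)).2].
exact: (gP (_, _)).1.
Qed.

Section weak_compactness.
Variables (R : realType) (k : scalar_kind).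
Local Notation K := (scalar_field R k).

Definition halfX (n : nat) : R := 2^-1 ^+ n.

Lemma halfX_gt0 n : 0 < halfX n.
Proof. by rewrite exprn_gt0// invr_gt0. Qed.

Lemma halfXS n : halfX n.+1 = halfX n / 2.
Proof. by rewrite /halfX exprSr. Qed.

Lemma sum_halfX n : \sum_(i < n) halfX i = 2 - 2 * halfX n.
Proof.
elim: n => [|n IH]; first by rewrite big_ord0 /halfX expr0; lra.
rewrite big_ord_recr/= IH halfXS; lra.
Qed.

Lemma halfX_le n : halfX n * n.+1%:R <= 1.
Proof.
elim: n => [|n IH]; first by rewrite mulr1 /halfX expr0.
rewrite halfXS; apply: le_trans IH.
rewrite -[n.+2%:R]natr1 -[n.+1%:R]natr1.
by have := halfX_gt0 n; have : 0 <= n%:R :> R by []; nra.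
Qed.

Lemma halfX_small e : 0 < e -> exists N, forall n, (N <= n)%N -> halfX n < e.
Proof.
move=> e0; exists (Num.truncn e^-1).+1 => n Nn.
have h : e^-1 < n.+1%:R.
  by apply: lt_le_trans (truncnS_gt _) _; rewrite ler_nat ltnW.
have h1 : 1 < e * n.+1%:R by rewrite -ltr_pdivrMl// mulr1.
have n0 : 0 < n.+1%:R :> R by [].
rewrite -(ltr_pM2r n0); exact: le_lt_trans (halfX_le n) h1.
Qed.

Lemma halfX_le1 n : halfX n <= 1.
Proof. by rewrite exprn_ile1// invf_le1// ler1n. Qed.

Lemma halfX_anti m n : (m <= n)%N -> halfX n <= halfX m.
Proof. by move=> mn; rewrite ler_wiXn2l// invf_le1// ler1n. Qed.

(** A gliding hump: if |x_n| were unbounded, one could pick x_(n_i) so large that the term 4^-i f_i,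
    with f_i norming x_(n_i), dominates there the bounded contribution of the earlier terms and i;
    the sum of the terms would be unbounded along x. *)
Lemma wnull_bounded (E : normedModType K) (x : nat -> E) :
  wnull x -> exists M, forall n, nrm (x n) <= M.
Proof.
move=> wx; apply: contrapT => xM.
have big M : exists n, M < nrm (x n).
  apply: contrapT => h; apply: xM; exists M => n; rewrite leNgt; apply/negP => Mn.
  by apply: h; exists n.
(* With ratio 4, the tail beyond index i is at most a third of the i-th term at x_(n_i). *)
pose q (n : nat) : R := 4^-1 ^+ n.
have q0 n : 0 < q n by rewrite exprn_gt0// invr_gt0.
have qS n : q n.+1 = q n / 4 by rewrite /q exprSr.
have /choice[g gP] : forall ih : nat * dual E, exists nf : nat * dual E,
    [/\ forall y, nrm (nf.2 y) <= nrm y, nrm (nf.2 (x nf.1)) = nrm (x nf.1) &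
     exists2 C, forall n, nrm (ih.2 (x n)) <= C & 2 * (C + ih.1%:R) <=
       q ih.1 * nrm (x nf.1)].
  move=> [i h]; have [C hC] := rcvg_bounded (wx h).
  have [n xn] := big (2 * (C + i%:R) / q i); have [f f1 fx] := norming (x n).
  exists (n, f); split=> //=; exists C => //.
  by rewrite (mulrC (q i)) -ler_pdivrMr// ltW.
pose G := fix G n : dual E :=
  if n is m.+1 then G m + ofR k (q m) *: (g (m, G m)).2 else 0.
have GS n y : G n.+1 y = G n y + ofR k (q n) *: ((g (n, G n)).2 y) by [].
have Gtail m j y : nrm (G (m + j)%N y - G m y) <= 4 / 3 * (q m - q (m + j)%N) * nrm y.
  elim: j => [|j IH]; first by rewrite addn0 !subrr nrm0 mulr0 mul0r.
  rewrite addnS GS addrAC (le_trans (nrmD _ _))//.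
  have [+ _ _] := gP ((m + j)%N, G (m + j)%N) => /(_ y).
  rewrite nrmZ nrm_ofR gtr0_norm// qS => h.
  have := ler_wpM2l (ltW (q0 (m + j)%N)) h; lra.
have G2 n y : nrm (G n y) <= 2 * nrm y.
  have := Gtail 0 n y; rewrite add0n subr0 => /le_trans; apply.
  apply: ler_wpM2r; first exact: nrm_ge0.
  have := q0 n; rewrite /q expr0; lra.
(* The sum of the series is taken as a cluster functional of its partial sums. *)
have [||psi psi2 psiP] := @cluster_functional _ _ E (fun n => G n) 2 => //.
  by move=> n; exact: bop_linear.
have [M psiM] := rcvg_bounded (wx psi).
pose i := (Num.truncn (M + 1)).+1.
have iM : M + 1 < i%:R by exact: truncnS_gt.
have [f1 fx [C GC xC]] := gP (i, G i).
set n := (g (i, G i)).1 in fx xC.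
have [N Ni /(_ (x n))] := psiP [:: x n] 1 i.+1 ltr01.
rewrite mem_head => /(_ isT) hN.
have := Gtail i.+1 (N - i.+1)%N (x n); rewrite subnKC// GS => hT.
have h2 : 4 / 3 * (q i.+1 - q N) * nrm (x n) <= 1 / 3 * (q i * nrm (x n)).
  rewrite qS mulrA; apply: ler_wpM2r; first exact: nrm_ge0.
  have := q0 N; lra.
have h3 : q i * nrm (x n) = nrm (ofR k (q i) *: ((g (i, G i)).2 (x n))).
  by rewrite nrmZ nrm_ofR gtr0_norm// fx.
set a := G i (x n) in hT *; set b := ofR _ _ *: _ in h3 hT.
set c := G N (x n) in hN hT.
have hb : nrm b <= nrm (c - (a + b)) + nrm (c - psi (x n)) + nrm (psi (x n)) + nrm a.
  have bE : b = - (c - (a + b)) + (c - psi (x n)) + psi (x n) - a.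
    by rewrite -[- _ + _ + _]addrA subrK opprB subrK addrC addKr.
  rewrite {1}bE.
  have := nrmD (- (c - (a + b)) + (c - psi (x n)) + psi (x n)) (- a).
  have := nrmD (- (c - (a + b)) + (c - psi (x n))) (psi (x n)).
  have := nrmD (- (c - (a + b))) (c - psi (x n)); rewrite !nrmN; lra.
have hp1 : nrm (psi (x n)) <= M := psiM n; have ha : nrm a <= C := GC n.
have xC' : 2 * (C + i%:R) <= nrm b by rewrite -h3.
have a0 := nrm_ge0 a; rewrite h3 in h2; have hab := le_trans hT h2.
have := nrm_ge0 (psi (x n)); lra.
Qed.

Lemma scalar_dense : exists d : nat -> K^o, forall z e, 0 < e ->
  exists n, nrm (z - d n) < e.
Proof.
have [im [j [j1 imz zE]]] := scalar_coordinates R k.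
pose d n : K^o := if unpickle n is Some pq then
  ofR k (ratr (pq.1 : rat)) + ofR k (ratr (pq.2 : rat)) * j else 0.
have dense (t e : R) : 0 < e -> exists p : rat, `|t - ratr p| < e.
  move=> e0; have te : t - e < t + e by lra.
  have [p] := rat_in_itvoo te.
  rewrite in_itv/= => /andP[h1 h2]; exists p; rewrite ltr_norml.
  by apply/andP; split; lra.
exists d => z e e0; have e2 : 0 < e / 2 by lra.
have [p pP] := dense (toR z) _ e2; have [q qP] := dense (im z) _ e2.
exists (pickle (p, q)); rewrite /d pickleK /=.
have -> : z - (ofR k (ratr p) + ofR k (ratr q) * j) =
    ofR k (toR z - ratr p) + ofR k (im z - ratr q) * j :> K^o.
  by rewrite {1}(zE z) !ofRB mulrBl opprD addrACA.
rewrite (le_lt_trans (nrmD _ _))// nrmM !nrm_ofR.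
have : `|im z - ratr q| * nrm j <= `|im z - ratr q| * 1 by rewrite ler_wpM2l.
by rewrite mulr1; lra.
Qed.

Section sequence_span.
Variables (E : normedModType K) (x : nat -> E).

Definition seq_span : set E :=
  [set w | exists N (a : nat -> K), w = \sum_(i < N) a i *: x i].

Lemma seq_span_widen N M (a : nat -> K) : (N <= M)%N ->
  \sum_(i < N) a i *: x i = \sum_(i < M) (if (i < N)%N then a i else 0) *: x i.
Proof.
move=> NM; rewrite (big_ord_widen M (fun i => a i *: x i) NM) big_mkcond/=.
by apply: eq_bigr => i _; case: ifP => //; rewrite scale0r.
Qed.

Lemma seq_span_lin (a b : K) v w : seq_span v -> seq_span w ->
  seq_span (a *: v + b *: w).
Proof.
move=> [N [c ->]] [M [d ->]]; exists (maxn N M).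
exists (fun i =>
  a * (if (i < N)%N then c i else 0) + b * (if (i < M)%N then d i else 0)).
rewrite (seq_span_widen c (leq_maxl N M)) (seq_span_widen d (leq_maxr N M)).
rewrite !scaler_sumr -big_split; apply: eq_bigr => i _.
by rewrite /= !scalerA -scalerDl.
Qed.

Lemma seq_span_gen a i : seq_span (a *: x i).
Proof.
exists i.+1, (fun j => if j == i then a else 0).
rewrite big_ord_recr/= eqxx big1 ?add0r// => j _.
by rewrite (ltn_eqF (ltn_ord j)) scale0r.
Qed.

Lemma seq_span_dense : exists q : nat -> E, forall w e, seq_span w -> 0 < e ->
  exists m, nrm (w - q m) < e.
Proof.
have [d dP] := scalar_dense.
exists (fun m => if (unpickle m : option (seq nat)) is Some s then
  \sum_(i < size s) d (nth 0%N s i) *: x i else 0) => _ e [N [a ->]] e0.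
have /choice[t tP] :
  forall i, exists n, nrm (a i - d n) < e * halfX i / (4 * (nrm (x i) + 1)).
  move=> i; apply: dP; have := nrm_ge0 (x i) => ?.
  rewrite divr_gt0 ?mulr_gt0 ?halfX_gt0//; lra.
exists (pickle (mkseq t N)); rewrite pickleK size_mkseq.
rewrite -sumrB (le_lt_trans (nrm_sum _ _ _))//.
apply: (@le_lt_trans _ _ (\sum_(i < N) (e / 4 * halfX i))); last first.
  rewrite -mulr_sumr sum_halfX; have := halfX_gt0 N; nra.
apply: ler_sum => i _; rewrite nth_mkseq// -scalerBl nrmZ.
have x0 := nrm_ge0 (x i); have x1 : 0 < nrm (x i) + 1 by lra.
have := tP i; rewrite ltr_pdivlMr; last by lra.
have := nrm_ge0 (a i - d (t i)); nra.
Qed.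

End sequence_span.

(** The evaluations f |-> f (x n) have a cluster functional in the bidual, which reflexivity turns
    into a point l. *)
Lemma reflexive_cluster (E : normedModType K) (x : nat -> E) C :
  reflexive_space E -> (forall n, nrm (x n) <= C) ->
  exists l, forall (s : seq (dual E)) e N, 0 < e ->
    exists2 n, (N <= n)%N & forall f, f \in s -> nrm (f (x n) - f l) < e.
Proof.
move=> rE xC.
have [||psi _ psiP] := @cluster_functional R k (dual E) (fun n f => f (x n)) C.
- by [].
- move=> n f; rewrite mulrC (le_trans (nrm_opP f (x n)))// ler_wpM2l//.
  exact: nrm_ge0.
have [l lP] := rE psi; exists l => s e N e0.
by have [n Nn h] := psiP s e N e0; exists n => // f fs; rewrite -lP; exact: h.
Qed.

(* Countably many functionals norm the closed span of the sequence, hence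
   separate its weak cluster points: a subsequence along which they all
   converge has a single weak cluster point. *)
Lemma reflexive_subsequence (E : normedModType K) (x : nat -> E) C :
  reflexive_space E -> (forall n, nrm (x n) <= C) ->
  exists (s : nat -> nat) (l : E), (forall n, (s n < s n.+1)%N) /\
    wnull (fun n => x (s n) - l).
Proof.
move=> rE xC; have [q qP] := seq_span_dense x.
have /choice[f fP] : forall m, exists f : dual E,
    (forall y, nrm (f y) <= nrm y) /\ nrm (f (q m)) = nrm (q m).
  by move=> m; have [f f1 f2] := norming (q m); exists f.
have [l lP] := reflexive_cluster rE xC.
have [|s sincr sP] := @diagonal_subsequence (fun i n => forall m, (m <= i)%N ->
    nrm (f m (x n) - f m l) < halfX i).
  move=> i N; have [n Nn h] := lP (map f (iota 0 i.+1)) _ N (halfX_gt0 i).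
  by exists n => // m mi; apply: h; apply: map_f; rewrite mem_iota.
exists s, l; split=> // g; apply: contrapT => /existsNP[e /not_implyP[e0 ge]].
have [|t tincr tP] := @infinite_subsequence (fun n => e <= nrm (g (x (s n) - l))).
  move=> N; apply: contrapT => h; apply: ge; exists N => n Nn; rewrite subr0 ltNge.
  by apply/negP => hn; apply: h; exists n.
have [l' l'P] := reflexive_cluster rE (fun n => xC (s (t n))).
have [v vE] : exists v, v = l' - l by exists (l' - l).
have gv : g v != 0.
  apply/negP => /eqP gv0; have e2 : 0 < e / 2 by lra.
  have [n _ /(_ g)] := l'P [:: g] _ 0 e2; rewrite mem_head => /(_ isT).
  have := tP n; rewrite bopB; have -> : g l = g l'; last by lra.
  by apply/esym/eqP; rewrite -subr_eq0 -bopB -vE gv0.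
have v0 : v != 0 by apply: contraNneq gv => ->; rewrite bop0.
(* [f m] converges to [f m l] along s, and l' is a weak cluster point of a further subsequence. *)
have fv m : f m v = 0.
  apply: nrm_eq0; apply/eqP; rewrite eq_le nrm_ge0 andbT.
  apply/ler_addgt0Pr => d d0; rewrite add0r; have d2 : 0 < d / 2 by lra.
  have [N NP] := halfX_small d2.
  have [n Nn /(_ (f m))] := l'P [:: f m] _ (maxn N m) d2; rewrite mem_head => /(_ isT).
  have tn := increasing_ge tincr n.
  have := sP (t n) m (leq_trans (leq_trans (leq_maxr N m) Nn) tn).
  have := NP _ (leq_trans (leq_trans (leq_maxl N m) Nn) tn).
  have := nrm_tri (f m l') (f m (x (s (t n)))) (f m l).
  rewrite (nrmBC (f m l') (f m (x _))) vE bopB; lra.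
have nv0 := nrm_gt0 v0; pose e' := nrm v / 4; have e'0 : 0 < e' by rewrite /e'; lra.
(* v is close to the span of x: a functional g' separating it from the span vanishes on the span,
   hence at the weak cluster points l and l', hence at v. *)
have [w ws wv] : exists2 w, seq_span x w & nrm (v - w) < e'.
  apply: contrapT => h.
  have [||g' _ g'P] := @mazur _ _ _ [set v - w | w in seq_span x] e'.
  - move=> _ _ a b [w ws <-] [w' ws' <-] _ _ ab.
    exists (ofR k a *: w + ofR k b *: w'); first exact: seq_span_lin.
    by rewrite !scalerBr addrACA -opprD -scalerDl -ofRD ab ofR1 scale1r.
  - move=> _ [w ws <-]; rewrite leNgt; apply/negP => vw; apply: h; by exists w.
  have g'x i : g' (x i) = 0.
    apply/eqP/negPn/negP => g'i.
    (* With this a, the real part of g' is 0 at v - a x_i, against the lower bound e' > 0. *)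
    pose a := ofR k (toR (g' v)) / g' (x i).
    have : e' <= toR (g' (v - a *: x i)).
      by apply: g'P; exists (a *: x i) => //; exact: seq_span_gen.
    rewrite bopB bopZ -[a *: _]/(a * g' (x i)) mulfVK// toRD toRN toRK; lra.
  have g'0 y (z : nat -> nat) : (forall (s : seq (dual E)) e N, 0 < e ->
      exists2 n, (N <= n)%N & forall f, f \in s -> nrm (f (x (z n)) - f y) < e) ->
        g' y = 0.
    move=> zP; apply: nrm_eq0; apply/eqP; rewrite eq_le nrm_ge0 andbT.
    apply/ler_addgt0Pr => d d0; rewrite add0r.
    have [n _ /(_ g')] := zP [:: g'] d 0 d0; rewrite mem_head => /(_ isT).
    by rewrite g'x sub0r nrmN => /ltW.
  have : e' <= toR (g' v).
    apply: g'P; exists 0; last by rewrite subr0.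
    by exists 0, (fun=> 0); rewrite big_ord0.
  rewrite vE bopB (g'0 l (fun n => n) lP) (g'0 l' (fun n =>
    s (t n)) l'P) subr0 toR0; lra.
(* [f m] norms [q m] and kills v, so |q m| <= |v - q m| < 2 e' = |v| / 2, which forces |v| < |v|. *)
have [m wm] := qP w e' ws e'0; have [f1 fq] := fP m.
have := f1 (v - q m); rewrite bopB fv sub0r nrmN fq.
have := nrm_tri v w (q m); have := ler_nrmB v (q m); rewrite /e' in wv wm; lra.
Qed.

End weak_compactness.

(** * Relations between the classes of operators *)

Section operator_classes.
Variables (R : realType) (k : scalar_kind).
Local Notation K := (scalar_field R k).
Local Notation halfX := (@halfX R).

Lemma ballE (F : normedModType K) (x y : F) (e : R) :
  ball x (ofR k e) y <-> nrm (x - y) < e.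
Proof. by rewrite -ball_normE /ball_/= -ofR_nrm ltr_ofR. Qed.

(** A Cauchy filter is followed through centres x_n of balls of radius 2^-n that belong to it. *)
Lemma sequentially_complete (V : normedModType K) :
  (forall u : nat -> V, (forall e : R, 0 < e -> exists N, forall m n,
     (N <= m)%N -> (N <= n)%N -> nrm (u m - u n) < e) -> exists l, rcvg u l) ->
  forall A : set_system V, ProperFilter A -> cauchy A -> cvg A.
Proof.
move=> Vc A PA /cauchyP Ac.
have /choice[x xP] : forall n, exists x, A (ball x (ofR k (halfX n))).
  by move=> n; apply: Ac; rewrite -ofR0 ltr_ofR halfX_gt0.
have [|l xl] := Vc x.
  move=> e e0; have e2 : 0 < e / 2 by lra.
  have [N NP] := halfX_small e2; exists N => m n Nm Nn.
  have [z [/ballE zm /ballE zn]] := filter_ex (filterI (xP m) (xP n)).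
  have := nrm_tri (x m) z (x n); rewrite (nrmBC z).
  have := NP m Nm; have := NP n Nn; lra.
apply/cvg_ex; exists l; apply/cvg_ballP => e e0.
have e2 : 0 < toR e / 2 by have := toR_gt0 e0; lra.
have [N1 h1] := xl _ e2; have [N2 h2] := halfX_small e2.
apply: filterS (xP (maxn N1 N2)) => z /ballE xz.
rewrite -(ofR_toR (ltW e0)); apply/ballE.
have := nrm_tri l (x (maxn N1 N2)) z; rewrite (nrmBC l (x _)).
have := h1 _ (leq_maxl N1 N2); have := h2 _ (leq_maxr N1 N2); lra.
Qed.

Lemma complete_rcvg (V : completeNormedModType K) (u : nat -> V) :
  (forall e : R, 0 < e -> exists N, forall m n, (N <= m)%N -> (N <= n)%N ->
     nrm (u m - u n) < e) -> exists l, rcvg u l.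
Proof.
move=> uC; suff /cauchy_cvg/cvg_ex[l /rcvgP ul] : cauchy (u @ \oo) by exists l.
apply/cauchyP => e e0; have [N NP] := uC _ (toR_gt0 e0); exists (u N).
exists N => // n /= Nn; rewrite -(ofR_toR (ltW e0)); apply/ballE; exact: NP.
Qed.

Lemma l1_ballP (a : K^nat) :
  l1_ball a <-> forall N, \sum_(i < N) nrm (a i : K^o) <= 1.
Proof.
have sE N : series (fun n => `|a n| : K) N = ofR k (\sum_(i < N) nrm (a i : K^o)).
  rewrite /series/= big_mkord (big_morph (ofR k) (@ofRD R k) (ofR0 R k)).
  by apply: eq_bigr => i _; rewrite ofR_nrm.
pose S N := \sum_(i < N) nrm (a i : K^o).
have Smono m n : (m <= n)%N -> S m <= S n.
  move=> /subnKC <-; elim: (n - m)%N => [|d IH]; first by rewrite addn0.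
  by rewrite addnS /S big_ord_recr/= (le_trans IH)// lerDl nrm_ge0.
split.
  move=> [/= + l1] N; rewrite leNgt => cs; apply/negP => SN.
  set l := limn _ in l1 cs.
  have /(@rcvgP R k K^o) sl : series (fun n => `|a n| : K) @ \oo --> (l : K) by [].
  pose e := S N - 1; have e0 : 0 < e by rewrite /e subr_gt0.
  have [M MP] := sl e e0.
  (* The inequality l <= 1 in K makes 1 - l real, hence l as well. *)
  have lr : l = ofR k (toR l).
    have h : 1 - l = ofR k (toR (1 - l)) by rewrite ofR_toR ?subr_ge0.
    have -> : l = 1 - (1 - l) by rewrite opprB addrCA subrr addr0.
    by rewrite h -ofR1 -ofRB toRK.
  have rl : toR l <= 1 by rewrite -(ler_ofR k) -lr ofR1.
  have := MP (maxn M N) (leq_maxl _ _); rewrite sE lr -ofRB nrm_ofR -/(S _).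
  have := Smono _ _ (leq_maxr M N); rewrite ltr_norml => ? /andP[_]; rewrite /e; lra.
move=> S1.
pose L := sup (range S).
have Ls : has_sup (range S).
  by split; [exists (S 0), 0 |exists 1 => _ [n _ <-]; exact: S1].
have sL : series (fun n => `|a n| : K) @ \oo --> (ofR k L : K).
  apply/(@rcvgP R k K^o) => e e0.
  have [_ [N _ <-] SN] := sup_adherent e0 Ls.
  exists N => n Nn; rewrite sE -ofRB nrm_ofR -/(S n) ltr_norml.
  have : S n <= L by apply: sup_upper_bound => //; exists n.
  have := Smono _ _ Nn; rewrite -/L in SN *; move=> *; apply/andP; split; lra.
split=> /=; first by apply/cvg_ex; exists (ofR k L).
rewrite (cvg_lim _ sL)//.
rewrite -ofR1 ler_ofR; apply: ge_sup; first by case: Ls.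
by move=> _ [n _ <-]; exact: S1.
Qed.

Lemma rcvg_series (F : normedModType K) (a : K^nat) (x : nat -> F) y :
  [series a n *: x n]_n @ \oo --> y <-> rcvg (fun N => \sum_(i < N) a i *: x i) y.
Proof.
rewrite rcvgP;
  suff -> : [series a n *: x n]_n = (fun N => \sum_(i < N) a i *: x i) by [].
by apply/funext => N; rewrite /series/= big_mkord.
Qed.

Lemma rcvg_op (E F : normedModType K) (T : bounded_op E F) (x : nat ->
  E) l : rcvg x l -> rcvg (T \o x) (T l).
Proof.
move=> xl e e0; have T0 := nrm_ge0 T; have T1 : 0 < nrm T + 1 by lra.
have [N NP] := xl _ (divr_gt0 e0 T1); exists N => n /NP.
rewrite /= -bopB ltr_pdivlMr// mulrC; have := nrm_opP T (x n - l).
have := nrm_ge0 (x n - l); rewrite mulrDl; lra.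
Qed.

Lemma rcvg_wnull (F : normedModType K) (x : nat -> F) : rcvg x 0 -> wnull x.
Proof. by move=> x0 f; have := rcvg_op f x0; rewrite bop0. Qed.

Lemma rcvg_ext (F : normedModType K) (u v : nat -> F) l :
  (forall n, u n = v n) -> rcvg v l -> rcvg u l.
Proof. by move=> uv; have -> : u = v by apply/funext. Qed.

Lemma rcvgD (F : normedModType K) (u v : nat -> F) l m :
  rcvg u l -> rcvg v m -> rcvg (fun n => u n + v n) (l + m).
Proof.
move=> ul vm e e0; have e2 : 0 < e / 2 by lra.
have [N1 h1] := ul _ e2; have [N2 h2] := vm _ e2; exists (maxn N1 N2) => n.
rewrite geq_max => /andP[/h1 ? /h2 ?]; rewrite opprD addrACA.
by have := nrmD (u n - l) (v n - m); lra.
Qed.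

Lemma rcvgZ (F : normedModType K) (c : K^o) (u : nat -> F) l :
  rcvg u l -> rcvg (fun n => c *: u n) (c *: l).
Proof.
move=> ul e e0; have c0 := nrm_ge0 c; have c1 : 0 < nrm c + 1 by lra.
have [N NP] := ul _ (divr_gt0 e0 c1); exists N => n /NP.
rewrite -scalerBr nrmZ ltr_pdivlMr//; have := nrm_ge0 (u n - l); lra.
Qed.

Lemma rcvg_sum (F : normedModType K) (I : Type) (r : seq I) (u : nat -> I -> F) l :
  (forall i, rcvg (u^~ i) (l i)) ->
  rcvg (fun n => \sum_(i <- r) u n i) (\sum_(i <- r) l i).
Proof.
move=> ul; elim: r => [|i r IH].
  by move=> e e0; exists 0%N => n _; rewrite !big_nil subr0 nrm0.
rewrite big_cons; apply: (@rcvg_ext _ _ (fun n => u n i + \sum_(j <- r) u n j)).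
  by move=> n; rewrite big_cons.
exact: rcvgD.
Qed.

Definition tot_bounded (F : normedModType K) (A : set F) := forall e : R, 0 < e ->
  exists s : seq F, forall a, A a -> exists2 b, b \in s & nrm (a - b) < e.

Lemma not_tot_bounded (F : normedModType K) (A : set F) : ~ tot_bounded A ->
  exists2 e : R, 0 < e & exists x : nat -> F, (forall n, A (x n)) /\
    forall m n, (m < n)%N -> e <= nrm (x n - x m).
Proof.
move=> /existsNP[e /not_implyP[e0 /forallNP he]]; exists e => //.
have [s|x xP] :=
  @dependent_sequence F (fun s a => A a /\ forall b, b \in s -> e <= nrm (a - b)).
  have /existsNP[a /not_implyP[Aa ha]] := he s; exists a; split=> // b bs.
  by rewrite leNgt; apply/negP => hb; apply: ha; exists b.
exists x; split=> [n|m n mn]; first by have [] := xP n.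
by apply: (xP n).2; apply: map_f; rewrite mem_iota.
Qed.

Lemma precompact_tot_bounded (F : normedModType K) (A : set F) :
  precompact A -> tot_bounded A.
Proof.
rewrite precompactE => cA; apply: contrapT => /not_tot_bounded[e e0 [x [Ax xe]]].
have [|p [_ xp]] := cA (x @ \oo) _.
  by exists 0 => // n _; apply: subset_closure; exact: Ax.
have e2 : 0 < e / 2 by lra.
have bp : nbhs p (ball p (ofR k (e / 2))).
  by apply: nbhsx_ballx; rewrite -ofR0 ltr_ofR.
have near_p N : exists2 n, (N <= n)%N & nrm (p - x n) < e / 2.
  have [|_ [[n /= Nn <-] /ballE h]] := xp [set x n | n in [set n | (N <= n)%N]] _ _ bp.
    by exists N => // n Nn; exists n.
  by exists n.
have [m _ hm] := near_p 0; have [n mn hn] := near_p m.+1.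
have := xe _ _ mn; have := nrm_tri (x n) p (x m); rewrite (nrmBC (x n) p); lra.
Qed.

(** An ultrafilter on the closure of A contains one ball of each finite cover, so it is Cauchy. *)
Lemma tot_bounded_precompact (F : completeNormedModType K) (A : set F) :
  tot_bounded A -> precompact A.
Proof.
move=> tA; rewrite precompactE compact_ultra => U UU UA.
suff /cauchy_exP/cauchy_cvg Up : cauchy_ex U.
  exists (lim U); split=> //; apply: closed_closure.
  by move=> B /Up UB; exact: filter_ex (filterI UA UB).
move=> e e0; have r0 := toR_gt0 e0.
have r2 : 0 < toR e / 2 by lra.
have [s sP] := tA _ r2.
have cover : U [set a | exists2 b, b \in s & nrm (b - a) < toR e].
  apply: filterS UA => a Aa.
  have [|a' [Aa' /ballE h]] := Aa (ball a (ofR k (toR e / 2))) _.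
    by apply: nbhsx_ballx; rewrite -ofR0 ltr_ofR.
  have [b bs ab] := sP a' Aa'; exists b => //.
  by have := nrm_tri b a' a; rewrite (nrmBC b a') (nrmBC a' a); lra.
have [b Ub] : exists b, U [set a | nrm (b - a) < toR e].
  elim: s cover {sP} => [|b s IH] cover.
    by have [a [b]] := filter_ex cover.
  have [?|nb] := in_ultra_setVsetC [set a | nrm (b - a) < toR e] UU; first by exists b.
  apply: IH; apply: filterS (filterI cover nb) => a [[c + h] nh].
  by rewrite inE => /predU1P[ca|cs]; [rewrite ca in h|exists c].
exists b; apply: filterS Ub => a h; rewrite -(ofR_toR (ltW e0)); exact/ballE.
Qed.

Section operators.
Variables E F : normedModType K.
Implicit Type T : bounded_op E F.

Lemma ballP (x : E) : unit_ball E x <-> nrm x <= 1.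
Proof. by rewrite /unit_ball/= -ofR_nrm -ofR1 ler_ofR. Qed.

Definition ccont T := forall x : nat -> E, wnull x -> rcvg (T \o x) 0.

Lemma ccontP T : completely_continuous_ops E F T <-> ccont T.
Proof.
split=> h x wx; first by apply/rcvgP/h/weakly_null.
by apply/rcvgP/h/weakly_null.
Qed.

Lemma schur_ccont T : schur_property F -> ccont T.
Proof.
move=> sF x wx; have wTx := wnull_op T wx.
have /cvg_ex[m /rcvgP Tm] := sF _ _ ((weakly_null _).2 wTx).
suff <- : m = 0 by [].
apply: dual_separates => f; apply: (rcvg_unique _ (wTx f)).
exact: rcvg_op.
Qed.

Lemma wnull_limit_ball (x : nat -> E) l : wnull (fun n => x n - l) ->
  (forall n, nrm (x n) <= 1) -> nrm l <= 1.
Proof.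
move=> wx x1; have [f f1 fl] := norming l; rewrite -fl.
apply/ler_addgt0Pr => e /(wx f)[N /(_ N (leqnn _))]; rewrite subr0 /= bopB.
have := f1 (x N); have := x1 N; have := ler_nrmB (f l) (f (x N)).
rewrite nrmBC; lra.
Qed.

Lemma ccont_norm_attaining T : reflexive_space E -> ccont T -> norm_attaining_ops E F T.
Proof.
move=> rE cT.
have /choice[x xP] : forall n, exists x : E, nrm x <= 1 /\ nrm T - halfX n <= nrm (T x).
  move=> n; apply: contrapT => h.
  have : nrm T <= nrm T - halfX n.
    apply: nrm_op_sup => x x1; rewrite leNgt; apply/negP => hx.
    by apply: h; exists x; split=> //; exact: ltW.
  by have := halfX_gt0 R n; lra.
have [s [l [sincr wx]]] := reflexive_subsequence rE (fun n => (xP n).1).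
have l1 : nrm l <= 1 by apply: wnull_limit_ball wx _ => n; exact: (xP _).1.
exists l; first exact/ballP.
rewrite -!ofR_nrm; congr ofR; apply/eqP; rewrite eq_le; apply/andP; split.
  by apply: le_trans (nrm_opP T l) _; rewrite ler_piMr// nrm_ge0.
apply/ler_addgt0Pr => e e0; have e2 : 0 < e / 2 by lra.
have [N1 h1] := cT _ wx _ e2; have [N2 h2] := halfX_small e2.
have := h1 _ (leq_maxl N1 N2); rewrite subr0 /= bopB.
have sn := increasing_ge sincr (maxn N1 N2).
have := h2 _ (leq_trans (leq_maxr N1 N2) sn); have := (xP (s (maxn N1 N2))).2.
have := ler_nrmB (T (x (s (maxn N1 N2)))) (T l); lra.
Qed.

End operators.

Lemma ccont_compact (E : normedModType K) (F : completeNormedModType K)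
    (T : bounded_op E F) : reflexive_space E -> ccont T -> compact_ops E F T.
Proof.
move=> rE cT; apply: tot_bounded_precompact; apply: contrapT.
move=> /not_tot_bounded[e e0 [y [Ay ye]]].
have /choice[x xP] : forall n, exists x : E, nrm x <= 1 /\ T x = y n.
  by move=> n; have [x /ballP x1 xy] := Ay n; exists x.
have [s [l [sincr wx]]] := reflexive_subsequence rE (fun n => (xP n).1).
have e2 : 0 < e / 2 by lra.
have [N hN] := cT _ wx _ e2.
have := hN N (leqnn _); have := hN N.+1 (leqnSn _).
rewrite !subr0 /= !bopB !(xP _).2; have := ye _ _ (sincr N).
have := nrm_tri (y (s N.+1)) (T l) (y (s N)); rewrite (nrmBC (T l) (y (s N))); lra.
Qed.

(* Lists the blocks [L 0], [L 1], ... one after the other, so that a partial sum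
   of the resulting series is a partial sum over blocks. *)
Lemma enumerate_blocks (F : normedModType K) (L : nat -> seq F) (w : nat -> R) :
  (forall m, 0 < size (L m))%N ->
  (forall e : R, 0 < e -> exists M, forall m, (M <= m)%N -> forall u, u \in L m ->
    nrm u < e) ->
  (forall m, 0 <= w m) -> (forall M, \sum_(i < M) w i <= 1) ->
  exists2 x : nat -> F, rcvg x 0 &
    forall (c : nat -> F) y, (forall m, c m \in L m) ->
      rcvg (fun M => \sum_(i < M) ofR k (w i) *: c i) y ->
      exists2 a : nat -> K^o, forall N, \sum_(i < N) nrm (a i) <= 1 &
        rcvg (fun N => \sum_(i < N) a i *: x i) y.
Proof.
move=> L0 Ls w0 w1.
pose st := fix st p : nat * nat := if p is q.+1 then
  let: (m, r) := st q in if (r.+1 < size (L m))%N then (m, r.+1) else (m.+1, 0%N)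
  else (0%N, 0%N).
have stlt p : ((st p).2 < size (L (st p).1))%N.
  elim: p => [|p IH] /=; first exact: L0.
  by case: (st p) IH => m r /= IH; case: ifP.
have sto p : p = (\sum_(i < (st p).1) size (L i) + (st p).2)%N.
  elim: p => [|p IH] /=; first by rewrite big_ord0.
  move: (stlt p) IH; case: (st p) => m r /= rm pE.
  case: ltnP => rs /=; first by rewrite addnS -pE.
  by rewrite big_ord_recr/= addn0 {1}pE -addnS; congr addn; apply/eqP;
    rewrite eqn_leq rm rs.
have st_big M : exists P, forall p, (P <= p)%N -> (M <= (st p).1)%N.
  exists (\sum_(i < M) size (L i))%N => p Pp; rewrite leqNgt; apply/negP => pM.
  have : (p < \sum_(i < (st p).1.+1) size (L i))%N.
    by rewrite big_ord_recr/= {1}(sto p) ltn_add2l.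
  apply/negP; rewrite -leqNgt; apply: leq_trans Pp.
  rewrite (big_ord_widen M (fun i =>
    size (L i)) pM) [leqRHS](bigID (fun i : 'I_M => (i < (st p).1.+1)%N)) /=.
  exact: leq_addr.
exists (fun p => nth 0 (L (st p).1) (st p).2).
  move=> e /Ls[M MP]; have [P PP] := st_big M; exists P => p /PP Mp.
  by rewrite subr0; apply: MP Mp _ _; exact: mem_nth.
move=> c y cL cy.
pose idx m := index (c m) (L m).
pose a p : K^o := if (st p).2 == idx (st p).1 then ofR k (w (st p).1) else 0.
(* [lev p] counts the selected entries before position p: the partial sum up to p is the sum over
   the first [lev p] blocks. *)
pose lev p := ((st p).1 + (idx (st p).1 < (st p).2))%N.
have levS p : lev p.+1 = (lev p + ((st p).2 == idx (st p).1))%N.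
  rewrite /lev /=; move: (stlt p); case: (st p) => m r /= rm.
  have idxm : (idx m < size (L m))%N by rewrite index_mem.
  case: ltnP => rs /=.
    by rewrite ltnS leq_eqVlt (eq_sym r); case: eqVneq => [<-|];
      rewrite ?ltnn ?addn0 ?addn1//= addn1.
  have : (idx m <= r)%N by rewrite -ltnS (leq_trans idxm).
  rewrite addn0 leq_eqVlt => /predU1P[->|h]; first by rewrite ltnn eqxx addn0 addn1.
  by rewrite h (gtn_eqF h) addn1 addn0.
have levE p : (st p).2 = idx (st p).1 -> lev p = (st p).1.
  by rewrite /lev => ->; rewrite ltnn addn0.
exists a => [N|].
  suff -> : \sum_(i < N) nrm (a i) = \sum_(i < lev N) w i by [].
  elim: N => [|N IH]; first by rewrite !big_ord0.
  rewrite big_ord_recr/= IH levS /a; case: eqP => [h|_].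
    by rewrite addn1 big_ord_recr/= nrm_ofR ger0_norm// levE.
  by rewrite addn0 nrm0 addr0.
have sumE N : \sum_(i < N) a i *: nth 0 (L (st i).1) (st i).2 =
    \sum_(i < lev N) ofR k (w i) *: c i.
  elim: N => [|N IH]; first by rewrite !big_ord0.
  rewrite big_ord_recr/= IH levS /a; case: eqP => [h|_].
    by rewrite addn1 big_ord_recr/= levE// h nth_index.
  by rewrite addn0 scale0r addr0.
move=> e /cy[M MP]; have [P PP] := st_big M; exists P => p /PP Mp.
by rewrite sumE; apply: MP; rewrite (leq_trans Mp)// leq_addr.
Qed.

(** Grothendieck's argument: z is u_0 + sum (u_(m+1) - u_m) with u_m in a finite 4^-m-net and within
    4^-m of z. Divided by its weight 2^-(m+2), the difference still has norm below 8 * 2^-m, and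
    there are finitely many possible differences for each m. *)
Lemma compact_weakly_oo_compact (E F : normedModType K) (T : bounded_op E F) :
  compact_ops E F T -> weakly_oo_compact_ops E F T.
Proof.
move=> /precompact_tot_bounded tT.
pose q m : R := halfX m * halfX m.
have q0 m : 0 < q m by rewrite mulr_gt0 ?halfX_gt0.
have /choice[N NP] : forall m, exists s : seq F, forall a, (T @` unit_ball E) a ->
    exists2 b, b \in s & nrm (a - b) < q m.
  by move=> m; exact: tT.
pose D m : seq F := if m is m'.+1 then
    [seq ofR k (4 / halfX m') *: (uv.1 - uv.2) |
      uv <- [seq uv <- allpairs pair (N m) (N m') | nrm (uv.1 - uv.2) < 2 * q m']]
  else [seq ofR k 2 *: u | u <- N 0%N].
(* The entry 0 keeps every block nonempty, as [enumerate_blocks] requires. *)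
pose L m := 0 :: D m.
have [|e e0|m|M|x x0 xP] := @enumerate_blocks F L (fun m => halfX m.+1).
- by [].
- have e8 : 0 < e / 16 by lra.
  have [M MP] := halfX_small e8; exists M.+1 => -[//|m] Mm u.
  rewrite inE => /predU1P[->|/mapP[uv]]; first by rewrite nrm0.
  rewrite mem_filter => /andP[huv _] ->; have hm := halfX_gt0 R m.
  rewrite nrmZ nrm_ofR gtr0_norm ?divr_gt0//.
  have hM := MP m Mm.
  have : 4 / halfX m * nrm (uv.1 - uv.2) < 4 / halfX m * (2 * q m).
    by rewrite ltr_pM2l// divr_gt0.
  have -> : 4 / halfX m * (2 * q m) = 8 * halfX m by rewrite /q; field; rewrite gt_eqF.
  lra.
- exact/ltW/halfX_gt0.
- under eq_bigr => i _ do rewrite halfXS.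
  by rewrite -mulr_suml sum_halfX; have := halfX_gt0 R M; lra.
exists x; first exact/weakly_null/(rcvg_wnull x0).
move=> z Tz.
have /choice[u uP] : forall m, exists u, u \in N m /\ nrm (z - u) < q m.
  by move=> m; have [u um zu] := NP m z Tz; exists u.
pose c m := if m is m'.+1 then ofR k (4 / halfX m') *: (u m - u m') else ofR k 2 *: u 0%N.
have sumc M : \sum_(i < M.+1) ofR k (halfX i.+1) *: c i = u M.
  elim: M => [|M IH].
    by rewrite big_ord1 /= scalerA -ofRM halfXS [halfX 0]expr0 divfK// ofR1 scale1r.
  rewrite big_ord_recr/= IH scalerA -ofRM !halfXS.
  have -> : halfX M / 2 / 2 * (4 / halfX M) = 1 by field; rewrite gt_eqF ?halfX_gt0.
  by rewrite ofR1 scale1r addrC subrK.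
have qS m : q m.+1 <= q m.
  by rewrite /q ler_pM ?(ltW (halfX_gt0 _ _))// halfX_anti.
have cL m : c m \in L m.
  case: m => [|m]; rewrite inE; apply/orP; right; apply/mapP.
    by exists (u 0%N) => //; exact: (uP 0%N).1.
  exists (u m.+1, u m) => //; rewrite mem_filter /=; apply/andP; split; last first.
    by apply/allpairsP; exists (u m.+1, u m); split=> //;
      [exact: (uP _).1|exact: (uP _).1].
  have := nrm_tri (u m.+1) z (u m); have := (uP m).2; have := (uP m.+1).2.
  rewrite (nrmBC z (u m.+1)); have := qS m; lra.
have [|a a1 ax] := xP c z cL; last first.
  by exists a; [exact/l1_ballP|exact/rcvg_series].
move=> e /halfX_small[M MP]; exists M.+1 => -[//|n] Mn.
rewrite sumc nrmBC; apply: lt_trans (uP n).2 _; apply: le_lt_trans (MP n Mn).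
by rewrite /q ler_piMr ?halfX_le1// ltW// halfX_gt0.
Qed.

End operator_classes.

(** * Complete continuity of weakly oo-compact operators *)

Section weakly_oo_compact_operators.
Variables (R : realType) (k : scalar_kind).
Local Notation K := (scalar_field R k).
Local Notation halfX := (@halfX R).

(** Only the last term that exceeds its 2^-i costs M: all terms before it are at most 2^-i. *)
Lemma sum_hump (a : nat -> R) M N : (forall i, 0 <= a i <= M) ->
  (forall i, a i <= halfX i \/ forall l, (l < i)%N -> a l <= halfX i) ->
  \sum_(i < N) a i <= M + 2.
Proof.
move=> aM ah; have M0 : 0 <= M by have /andP[] := aM 0%N; exact: le_trans.
suff h : \sum_(i < N) a i <= M + \sum_(i < N) halfX i.
  by rewrite (le_trans h)// sum_halfX; have := halfX_gt0 R N; lra.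
elim: N => [|N IH]; first by rewrite !big_ord0; lra.
rewrite !big_ord_recr/=; have /andP[a0 aNM] := aM N.
have [aN|aN] := ah N; first by lra.
have : \sum_(i < N) a i <= \sum_(i < N) halfX i.
  by apply: ler_sum => i _; rewrite (le_trans (aN _ _))// halfX_anti// ltnW.
by have := halfX_gt0 R N; lra.
Qed.

Lemma bop_sumE (E F : normedModType K) (T : nat -> bounded_op E F) N x :
  (\sum_(i < N) T i : bounded_op E F) x = \sum_(i < N) T i x.
Proof.
elim: N => [|N IH]; first by rewrite !big_ord0.
by rewrite !big_ord_recr/= -IH.
Qed.

Lemma rcvg_seq (F : normedModType K) (I : eqType) (u : I -> nat -> F) (s : seq I) e :
  (forall i, rcvg (u i) 0) -> 0 < e ->
  exists N, forall n, (N <= n)%N -> forall i, i \in s -> nrm (u i n) < e.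
Proof.
move=> u0 e0; elim: s => [|i s [N IH]]; first by exists 0%N.
have [M MP] := u0 i e e0; exists (maxn M N) => n; rewrite geq_max => /andP[Mn Nn] j.
rewrite inE => /predU1P[->|]; last exact: IH.
by have := MP n Mn; rewrite subr0.
Qed.

(* Let [f_n] norm [T e_n], let [f] be a weak* cluster point of [f_n] and
   [D_n = f_n - f]. As [D_n] tends to 0 at each [x_j] and each [D_n] tends to 0
   along [x], a sparse series of the [D_n] is bounded on [x], hence on the image
   of the ball;
     it defines a functional on [E] that is large at infinitely many [e_n]. *)
Lemma weakly_oo_compact_ccont (E F : normedModType K) (T : bounded_op E F) :
  weakly_oo_compact_ops E F T -> ccont T.
Proof.
move=> [x /weakly_null wx Tx] e we; apply: contrapT => /existsNP[d /not_implyP[d0 hd]].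
have [|t tincr tP] := @infinite_subsequence (fun n => d <= nrm (T (e n))).
  move=> N; apply: contrapT => h; apply: hd; exists N => n Nn; rewrite subr0 ltNge.
  by apply/negP => hn; apply: h; exists n.
have wet := wnull_sub (increasing_ge tincr) we.
pose y n := T (e (t n)); have wy : wnull y := wnull_op T wet.
have /choice[f fP] : forall n, exists f : dual F,
    (forall z, nrm (f z) <= nrm z) /\ nrm (f (y n)) = nrm (y n).
  by move=> n; have [f f1 f2] := norming (y n); exists f.
have [||g g1 gP] := @cluster_functional _ _ F (fun n => f n) 1.
- by move=> n; exact: bop_linear.
- by move=> n z; rewrite mul1r; exact: (fP n).1.
have [D DE] : exists D : nat -> dual F, forall n z, D n z = f n z - g z.
  by exists (fun n => f n - g).
have D2 n z : nrm (D n z) <= 2 * nrm z.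
  by rewrite DE; have := nrmB (f n z) (g z); have := (fP n).1 z; have := g1 z; lra.
have [M xM] := wnull_bounded wx.
have d2 : 0 < d / 2 by lra.
have [N0 hN0] := wy g _ d2.
have Dy n : (N0 <= n)%N -> d / 2 <= nrm (D n (y n)).
  move=> /hN0; rewrite subr0 /= DE; have := ler_nrmB (f n (y n)) (g (y n)).
  by rewrite (fP n).2; have := tP n; rewrite -/(y n); lra.
have /choice[J JP] : forall s : seq nat, exists J, forall j, (J <= j)%N ->
    forall l, l \in s -> nrm (D l (x j)) < halfX (size s).
  by move=> s; apply: (@rcvg_seq K^o _ (fun l j => D l (x j))) => [l|];
    [exact: wx|exact: halfX_gt0].
(* The hump is at least d / 2. Against it stand cross terms of total at most 2 eta, an error below
   eta in approximating psi, and a value of psi below eta. *)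
pose eta := d / 16; have eta0 : 0 < eta by rewrite /eta; lra.
have eh m : 0 < eta * halfX m by rewrite mulr_gt0 ?halfX_gt0.
have [s|n nP] := @dependent_sequence nat (fun s n => [/\ (N0 <= n)%N,
    forall l, l \in s -> [/\ (l < n)%N, nrm (D n (y l)) < eta * halfX (size s) &
      nrm (D l (y n)) < eta * halfX (size s)] &
    forall j, (j < J s)%N -> nrm (D n (x j)) < halfX (size s)]).
  have [N1 hN1] :=
    @rcvg_seq K^o _ (fun l j => D l (y j)) s _ (fun l => wy (D l)) (eh (size s)).
  pose m0 := Num.min (eta * halfX (size s)) (halfX (size s)).
  have m00 : 0 < m0 by rewrite lt_min eh halfX_gt0.
  have [n] := gP (map y s ++ map x (iota 0 (J s))) m0
    (maxn N0 (maxn N1 (\max_(l <- s) l).+1)) m00.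
  rewrite !geq_max => /and3P[n0 n1 n2] hn; exists n; split=> // [l ls|j js].
    split; last exact: hN1.
      by apply: leq_ltn_trans n2; exact: (@leq_bigmax_seq _ _ xpredT id).
    have /hn : y l \in map y s ++ map x (iota 0 (J s)) by rewrite mem_cat map_f.
    by rewrite -DE /m0 lt_min => /andP[].
  have /hn : x j \in map y s ++ map x (iota 0 (J s)).
    by rewrite mem_cat map_f ?orbT// mem_iota.
  by rewrite -DE /m0 lt_min => /andP[].
have mem_n i j : (i < j)%N -> n i \in mkseq n j by move=> ij; rewrite map_f// mem_iota.
have nincr i : (n i < n i.+1)%N by have [_ /(_ (n i) (mem_n _ _ (ltnSn i)))[]] :=
  nP i.+1.
have cross i j : i != j -> nrm (D (n i) (y (n j))) <= eta * halfX i.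
  case: ltngtP => // ij _; apply/ltW.
    have [_ /(_ _ (mem_n _ _ ij))[_ _]] := nP j;
      rewrite size_mkseq => /lt_le_trans -> //.
    by rewrite ler_wpM2l ?(ltW eta0)// halfX_anti// ltnW.
  by have [_ /(_ _ (mem_n _ _ ij))[_ + _]] := nP i; rewrite size_mkseq.
(* If j is below the bound J of the first i indices, the i-th term is small by the choice of [n i];
   otherwise all earlier terms are small at x_j. *)
have hump j N : \sum_(i < N) nrm (D (n i) (x j)) <= 2 * M + 2.
  apply: (@sum_hump (fun i => nrm (D (n i) (x j)))) => i.
    by rewrite nrm_ge0/= (le_trans (D2 _ _))// ler_wpM2l.
  have [jJ|Jj] := ltnP j (J (mkseq n i)).
    by left; have [_ _ /(_ j jJ)] := nP i; rewrite size_mkseq => /ltW.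
  by right=> l li; have := JP _ j Jj _ (mem_n _ _ li); rewrite size_mkseq => /ltW.
have [S SE] : exists S : nat -> dual F, forall N z, S N z = \sum_(i < N) D (n i) z.
  by exists (fun N => \sum_(i < N) D (n i)) => N z;
    rewrite (@bop_sumE F K^o (fun i => D (n i))).
have Sx N j : nrm (S N (x j)) <= 2 * M + 2.
  by rewrite SE (le_trans (nrm_sum _ _ _)).
have C0 : 0 <= 2 * M + 2 by have := Sx 0%N 0%N; apply: le_trans; exact: nrm_ge0.
(* T z is an l_1-combination of the x_j with coefficients in the unit ball, so the bound at the x_j
   carries over. *)
have STC N z : nrm z <= 1 -> nrm (S N (T z)) <= 2 * M + 2.
  move=> z1; have [|a /l1_ballP a1 /rcvg_series ax] := Tx (T z).
    by exists z => //; exact/ballP.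
  apply/ler_addgt0Pr => r r0; have [P /(_ P (leqnn _))] := rcvg_op (S N) ax r0.
  rewrite /= nrmBC; have := ler_nrmB (S N (T z)) (S N (\sum_(i < P) a i *: x i)).
  suff : nrm (S N (\sum_(i < P) a i *: x i)) <= 2 * M + 2 by lra.
  rewrite bop_sum (le_trans (nrm_sum _ _ _))//.
  apply: (@le_trans _ _ (\sum_(i < P) nrm (a i : K^o) * (2 * M + 2))).
    by apply: ler_sum => i _; rewrite bopZ nrmZ ler_wpM2l// nrm_ge0.
  by rewrite -mulr_suml ler_piMl.
have /choice[H HE] : forall N, exists H : dual E, forall z, H z = S N (T z).
  by move=> N; exact: comp_dual.
have HC N : nrm (H N) <= 2 * M + 2 by apply: nrm_op_sup => z z1; rewrite HE; exact: STC.
(* The sums S N are controlled uniformly only on the image of the ball, so the cluster functional is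
   taken on E, after composition with T. *)
have [||psi _ psiP] := @cluster_functional _ _ E (fun n => H n) (2 * M + 2).
- by move=> N; exact: bop_linear.
- by move=> N z; rewrite (le_trans (nrm_opP _ _))// ler_wpM2r// nrm_ge0.
have [i /(_ i (leqnn _))] := wnull_sub (increasing_ge nincr) wet psi eta0.
rewrite subr0 /= => small.
have [N iN /(_ (e (t (n i))))] := psiP [:: e (t (n i))] eta i.+1 eta0.
rewrite mem_head HE SE => /(_ isT); rewrite (bigD1 (Ordinal iN))//= -/(y (n i)).
set A := D (n i) (y (n i)); set B := \sum_(_ < _ | _) _ => hAB.
have B2 : nrm B <= 2 * eta.
  rewrite (le_trans (nrm_sum _ _ _))//.
  apply: (@le_trans _ _ (\sum_(j < N | j != Ordinal iN) eta * halfX j)).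
    by apply: ler_sum => j ji; exact: cross.
  apply: (@le_trans _ _ (\sum_(j < N) eta * halfX j)).
    by rewrite [leRHS](bigD1 (Ordinal iN))//= lerDr ltW.
  by rewrite -mulr_sumr sum_halfX; have := halfX_gt0 R N; nra.
have [n0 _ _] := nP i; have := Dy _ n0; rewrite -/A.
have := ler_nrmB (A + B) (psi (e (t (n i)))); have := ler_nrmB A (- B).
by rewrite opprK nrmN; move: B2 small hAB; rewrite /eta; lra.
Qed.

End weakly_oo_compact_operators.

(** * The reflexive space attached to a weakly null sequence *)

Lemma big_nat_ord (V : nmodType) M p q (G : nat -> V) : (q <= M)%N ->
  \sum_(p <= i < q) G i = \sum_(i < M) if (p <= i < q)%N then G i else 0.
Proof.
move=> qM; rewrite big_geq_mkord (big_ord_widen_cond M (fun i => p <= i)%N G qM).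
by rewrite big_mkcond.
Qed.

Lemma sum_uniq (b : nat -> bool) N : (forall i j, b i -> b j -> i = j) ->
  (\sum_(i < N) b i <= 1)%N.
Proof.
move=> b1; elim: N => [|N IH]; first by rewrite big_ord0.
rewrite big_ord_recr/=; have [bN|] := boolP (b N); last by rewrite addn0.
rewrite big1// => i _; have [bi|//] := boolP (b i).
by have := ltn_ord i; rewrite (b1 _ _ bi bN) ltnn.
Qed.

Section interpolation_space.
Variables (R : realType) (k : scalar_kind).
Local Notation K := (scalar_field R k).
Local Notation halfX := (@halfX R).
Variable F : completeNormedModType K.

(** Bundled, so that the space and its structures depend on the single argument y. *)
Record unit_wnull := UnitWnull {
  uw_seq :> nat -> F;
  uw_nrm : forall n, nrm (uw_seq n) = 1;
  uw_null : wnull uw_seq }.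

Variable y : unit_wnull.
Implicit Types a b : nat -> K^o.

(* The piece [(c, f, p, q)] stands for the functional
   [a |-> c * \sum_(p <= n < q) a n * f (y n)]. *)
Definition piece := (K^o * dual F * nat * nat)%type.
Implicit Types (s : piece) (l : seq piece).

Definition cf s := s.1.1.1.
Definition fn s := s.1.1.2.
Definition inp s n := (s.1.2 <= n < s.2)%N.
Definition pval s a : K^o := \sum_(s.1.2 <= n < s.2) a n * fn s (y n).
Definition kap l a : K^o := \sum_(s <- l) cf s * pval s a.

(** Disjointness is expressed by counting the pieces that contain n, which behaves well under
    concatenation and restriction of lists. *)
Definition valid l := [/\
  forall s, s \in l -> forall n, inp s n -> nrm (fn s) * nrm (fn s (y n)) <= 1,
  \sum_(s <- l) nrm (cf s) ^+ 2 <= 1 &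
  forall n, (\sum_(s <- l) inp s n <= 1)%N].

Lemma pvalD s a b : pval s (a + b) = pval s a + pval s b.
Proof. by rewrite -big_split/=; apply: eq_bigr => n _; rewrite mulrDl. Qed.

Lemma pvalZ s c a : pval s (c *: a) = c * pval s a.
Proof. by rewrite mulr_sumr; apply: eq_bigr => n _; rewrite mulrA. Qed.

Lemma kapD l a b : kap l (a + b) = kap l a + kap l b.
Proof. by rewrite -big_split/=; apply: eq_bigr => s _; rewrite pvalD mulrDr. Qed.

Lemma kapZ l c a : kap l (c *: a) = c * kap l a.
Proof. by rewrite mulr_sumr; apply: eq_bigr => s _; rewrite pvalZ mulrCA. Qed.

Lemma kap0 l : kap l 0 = 0.
Proof. by rewrite -(scale0r 0) kapZ mul0r. Qed.

Lemma kap_sum l (v : nat -> nat -> K^o) N :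
  kap l (\sum_(i < N) v i) = \sum_(i < N) kap l (v i).
Proof.
elim: N => [|N IH]; first by rewrite !big_ord0 kap0.
by rewrite !big_ord_recr/= kapD IH.
Qed.

Definition trunc m n a : nat -> K^o := fun i => if (m <= i < n)%N then a i else 0.

Definition restr m n l : seq piece :=
  [seq (s.1.1, maxn m s.1.2, minn n s.2) | s <- l].

Lemma pval_restr m n s a : pval (s.1.1, maxn m s.1.2, minn n s.2) a =
  pval s (trunc m n a).
Proof.
rewrite /pval /fn /=.
rewrite (big_nat_ord _ _ (geq_minr n s.2)) (big_nat_ord _ _ (leqnn s.2)).
apply: eq_bigr => i _; rewrite /trunc geq_max leq_min andbACA andbC.
by case: (s.1.2 <= i < s.2)%N => //=; case: (m <= i < n)%N; rewrite ?mul0r.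
Qed.

Lemma kap_restr m n l a : kap (restr m n l) a = kap l (trunc m n a).
Proof. by rewrite /kap big_map; apply: eq_bigr => s _; rewrite pval_restr. Qed.

Lemma inp_restr m n s i : inp (s.1.1, maxn m s.1.2, minn n s.2) i =
  (m <= i < n)%N && inp s i.
Proof.
by rewrite /inp /= geq_max leq_min andbACA.
Qed.

Lemma valid_restr m n l : valid l -> valid (restr m n l).
Proof.
move=> [h1 h2 h3]; split.
- move=> _ /mapP[s sl ->] i; rewrite inp_restr => /andP[_]; exact: h1.
- by rewrite big_map.
- move=> i; rewrite big_map; apply: leq_trans (h3 i).
  by apply: leq_sum => s _; rewrite inp_restr; case: (m <= i < n)%N.
Qed.

Definition scale_pieces (u : K^o) l : seq piece :=
  [seq (u * cf s, fn s, s.1.2, s.2) | s <- l].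

Lemma kap_scale u l a : kap (scale_pieces u l) a = u * kap l a.
Proof. by rewrite /kap big_map mulr_sumr; apply: eq_bigr => s _; rewrite mulrA. Qed.

Lemma valid_scale u l : nrm u <= 1 -> valid l -> valid (scale_pieces u l).
Proof.
move=> u1 [h1 h2 h3]; split.
- by move=> _ /mapP[s sl ->] n sn; exact: (h1 s sl n sn).
- rewrite big_map; apply: le_trans h2; apply: ler_sum => s _; rewrite /cf /= nrmM.
  rewrite lerXn2r ?nnegrE ?mulr_ge0 ?nrm_ge0//.
  by rewrite ler_piMl ?nrm_ge0.
- by move=> n; rewrite big_map; exact: h3.
Qed.

Lemma valid_nil : valid [::].
Proof. by split=> [//||n]; rewrite big_nil. Qed.

Lemma valid_cf l s : valid l -> s \in l -> nrm (cf s) <= 1.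
Proof.
move=> [_ h _] sl; rewrite leNgt; apply/negP => c1.
move: h; rewrite leNgt => /negP; apply; rewrite (big_rem s)//=.
have : 1 < nrm (cf s) ^+ 2 by rewrite exprn_egt1.
have : 0 <= \sum_(t <- rem s l) nrm (cf t) ^+ 2 by apply: sumr_ge0 => t _;
  exact: sqr_ge0.
lra.
Qed.

Lemma valid1 (f : dual F) p q : (forall n, (p <= n < q)%N ->
  nrm f * nrm (f (y n)) <= 1) ->
  valid [:: (1, f, p, q)].
Proof.
move=> h; split=> [s||n]; last by rewrite big_seq1 leq_b1.
  by rewrite inE => /eqP ->; exact: h.
by rewrite big_seq1 /cf /= /nrm normr1 -ofR1 toRK expr1n.
Qed.

Lemma kap1 (f : dual F) p q a :
  kap [:: (1, f, p, q)] a = f (\sum_(p <= n < q) a n *: y n).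
Proof. by rewrite /kap big_seq1 mul1r bop_sum; apply: eq_bigr => n _; rewrite bopZ. Qed.

Definition kap_bounded a B := forall l, valid l -> nrm (kap l a) <= B.

Lemma kap_bounded_trunc m n a B : kap_bounded a B -> kap_bounded (trunc m n a) B.
Proof. by move=> aB l vl; rewrite -kap_restr; apply: aB; exact: valid_restr. Qed.

(** As |y_n| = 1, every f of norm at most 1 is a valid piece on any interval: the norm of G
    dominates the norm in F of all interval sums. *)
Lemma kap_bounded_vec a B p q : kap_bounded a B ->
  nrm (\sum_(p <= n < q) a n *: y n) <= B.
Proof.
move=> aB; set z := \sum_(_ <= _ < _) _; have [f f1 fz] := norming z.
rewrite -fz /z -kap1; apply: aB; apply: valid1 => n _.
have nf : nrm f <= 1 by apply: nrm_op_le => // x; rewrite mul1r.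
have := f1 (y n); rewrite uw_nrm => fy.
by rewrite mulr_ile1 ?nrm_ge0.
Qed.

Lemma kap_bounded_coord a B n : kap_bounded a B -> nrm (a n) <= B.
Proof.
move=> /(kap_bounded_vec n n.+1); rewrite big_nat1 nrmZ uw_nrm mulr1.
exact.
Qed.

Definition delta n : nat -> K^o := fun i => if i == n then 1 else 0.

(** Since |f (y_n)| <= |f|, the bound |f| |f (y_n)| <= 1 gives |f (y_n)|^2 <= 1. *)
Lemma valid_small l s n : valid l -> s \in l -> inp s n -> nrm (fn s (y n)) <= 1.
Proof.
move=> [h _ _] sl sn; have := h s sl n sn; have := nrm_opP (fn s) (y n).
rewrite uw_nrm mulr1; have := nrm_ge0 (fn s (y n)); nra.
Qed.

Lemma pval_delta s n : pval s (delta n) = if inp s n then fn s (y n) else 0.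
Proof.
rewrite /pval /delta /inp; case: ifP => [/andP[pn nq]|pnq].
  rewrite (bigD1_seq n) ?mem_index_iota ?pn ?iota_uniq//= eqxx mul1r.
  by rewrite big1 ?addr0// => i /negbTE ->; rewrite mul0r.
rewrite big_nat big1// => i; case: eqP => [->|]; last by rewrite mul0r.
by rewrite pnq.
Qed.

Lemma kap_bounded_delta n : kap_bounded (delta n) 1.
Proof.
move=> l vl; rewrite (le_trans (nrm_sum _ _ _))//.
have [_ _ /(_ n)] := vl; rewrite -(ler_nat R) natr_sum => /(le_trans _) -> //.
rewrite big_seq [leRHS]big_seq; apply: ler_sum => s sl.
rewrite pval_delta; case: ifP => [sn|_]; last by rewrite mulr0 nrm0.
by rewrite nrmM mulr_ile1 ?nrm_ge0//; [exact: valid_cf sl|exact: valid_small sl sn].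
Qed.

Lemma kapB l a b : kap l (a - b) = kap l a - kap l b.
Proof. by rewrite -scaleN1r kapD kapZ mulN1r. Qed.

(** All sequences of finite norm; that they lie in the closed span of the unit vectors is
    [basis_cvg]. *)
Definition interp_seq : {pred nat -> K^o} := mem [set a | exists B, kap_bounded a B].

Lemma interp_seqP a : reflect (exists B, kap_bounded a B) (a \in interp_seq).
Proof. exact/asboolP. Qed.

Lemma interp_submod_closed : submod_closed interp_seq.
Proof.
split; first by apply/interp_seqP; exists 0 => l _; rewrite kap0 nrm0.
move=> c a b /interp_seqP[A aA] /interp_seqP[B bB]; apply/interp_seqP.
exists (nrm (c : K^o) * A + B) => l vl; rewrite kapD kapZ (le_trans (nrmD _ _))//.
by rewrite lerD ?bB// nrmM ler_wpM2l ?nrm_ge0// aA.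
Qed.

HB.instance Definition _ :=
  GRing.isSubmodClosed.Build K (nat -> K^o) interp_seq interp_submod_closed.

Record interp := Interp { ival :> nat -> K^o; ivalP : ival \in interp_seq }.

HB.instance Definition _ := [isSub for ival].
HB.instance Definition _ := [Choice of interp by <:].
HB.instance Definition _ := [SubChoice_isSubLmodule of interp by <:].

Definition gnorm a : R := sup [set nrm (kap l a) | l in valid].

Lemma gnorm_ub a B l : kap_bounded a B -> valid l -> nrm (kap l a) <= gnorm a.
Proof.
move=> aB vl; apply: sup_upper_bound; last by exists l.
by split; [exists (nrm (kap l a)), l|exists B => _ [m vm <-]; exact: aB].
Qed.

Lemma gnorm_le a B : kap_bounded a B -> gnorm a <= B.
Proof.
move=> aB; apply: ge_sup; last by move=> _ [l vl <-]; exact: aB.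
by exists (nrm (kap [::] a)), [::] => //; exact: valid_nil.
Qed.

Lemma kap_gnorm (a : interp) : kap_bounded a (gnorm a).
Proof. by have /interp_seqP[B aB] := ivalP a => l; exact: gnorm_ub aB. Qed.

Definition inorm (a : interp) : K := ofR k (gnorm a).

Lemma inormD (a b : interp) : inorm (a + b) <= inorm a + inorm b.
Proof.
rewrite -ofRD ler_ofR; apply: gnorm_le => l vl; rewrite kapD.
by rewrite (le_trans (nrmD _ _))// lerD// kap_gnorm.
Qed.

Lemma inormZ (c : K) (a : interp) : inorm (c *: a) = `|c| * inorm a.
Proof.
have leZ (d : K) (b : interp) : inorm (d *: b) <= `|d| * inorm b.
  rewrite -[`|d|](@ofR_nrm R k K^o) -ofRM ler_ofR; apply: gnorm_le => l vl.
  by rewrite kapZ nrmM ler_wpM2l ?nrm_ge0// kap_gnorm.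
apply/eqP; rewrite eq_le leZ/=.
have [->|c0] := eqVneq c 0.
  rewrite normr0 mul0r scale0r -(ofR0 R k) ler_ofR (le_trans (nrm_ge0 (kap [::] 0)))//.
  exact: (@kap_gnorm 0 _ valid_nil).
have := leZ c^-1 (c *: a).
by rewrite scalerA mulVf// scale1r normfV ler_pdivlMl// normr_gt0.
Qed.

Lemma inorm0_eq0 (a : interp) : inorm a = 0 -> a = 0.
Proof.
move=> /(congr1 (@toR R k)); rewrite toRK toR0 => a0; apply/val_inj/funext => n /=.
apply: nrm_eq0; apply/eqP; rewrite eq_le nrm_ge0 andbT -a0.
exact: kap_bounded_coord (kap_gnorm a).
Qed.

HB.instance Definition _ :=
  Lmodule_isNormed.Build K interp inormD inormZ inorm0_eq0.

Lemma nrm_interp (a : interp) : nrm a = gnorm a.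
Proof. exact: toRK. Qed.

Lemma kap_nrm (a : interp) : kap_bounded a (nrm a).
Proof. rewrite nrm_interp; exact: kap_gnorm. Qed.

Lemma nrm_interp_le (a : interp) B : kap_bounded a B -> nrm a <= B.
Proof. rewrite nrm_interp; exact: gnorm_le. Qed.

Lemma make_interp a B : kap_bounded a B -> exists x : interp, x = a :> (nat -> K^o).
Proof.
move=> aB; have ax : a \in interp_seq by apply/interp_seqP; exists B.
by exists (Interp ax).
Qed.

Lemma ivalB (x z : interp) n : (x - z) n = x n - z n.
Proof. by []. Qed.

Lemma interp_coord (x : interp) n : nrm (x n) <= nrm x.
Proof. exact: kap_bounded_coord (kap_nrm x). Qed.

(** Each [kap l] depends on finitely many coordinates, so it passes to the coordinatewise limit; the
    Cauchy condition makes this uniform in l. *)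
Lemma interp_complete (u : nat -> interp) :
  (forall e, 0 < e -> exists N, forall m n, (N <= m)%N -> (N <= n)%N ->
     nrm (u m - u n) < e) ->
  exists x, rcvg u x.
Proof.
move=> uC.
have /choice[a aP] : forall i, exists x : K^o, rcvg (fun n => u n i) x.
  move=> i; apply: scalar_complete => e /uC[N NP]; exists N => m n Nm Nn.
  by apply: le_lt_trans (NP m n Nm Nn); exact: (interp_coord (u m - u n) i).
have kapC l : rcvg (fun n => kap l (u n)) (kap l a).
  apply: rcvg_sum => s; rewrite -[cf s * _]/(cf s *: _).
  apply: (rcvgZ (cf s)); apply: rcvg_sum => i.
  apply: (@rcvg_ext R k _ _ (fun n => fn s (y i) *: u n i)) => [n|].
    exact: mulrC.
  rewrite mulrC; exact: rcvgZ (aP i).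
have close e : 0 < e -> exists N, forall n, (N <= n)%N -> forall l, valid l ->
    nrm (kap l (u n) - kap l a) <= e.
  move=> e0; have [N NP] := uC e e0; exists N => n Nn l vl.
  apply/ler_addgt0Pr => d d0; have [M MP] := kapC l d d0.
  have := NP n (maxn M N) Nn (leq_maxr _ _); have := MP _ (leq_maxl M N).
  have := kap_nrm (u n - u (maxn M N)) vl.
  have -> : kap l (u n - u (maxn M N)) = kap l (u n) - kap l (u (maxn M N)).
    exact: kapB.
  have := nrm_tri (kap l (u n)) (kap l (u (maxn M N))) (kap l a); lra.
have [N0 hN0] := close 1 ltr01.
have [|x xE] := @make_interp a (nrm (u N0) + 1).
  move=> l vl; have := hN0 _ (leqnn _) l vl; have := kap_nrm (u N0) vl.
  have := nrmD (kap l a - kap l (u N0)) (kap l (u N0)); rewrite subrK nrmBC; lra.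
exists x => e e0; have e2 : 0 < e / 2 by lra.
have [N NP] := close _ e2; exists N => n Nn; apply: (@le_lt_trans _ _ (e / 2));
  last by lra.
apply: nrm_interp_le => l vl; have := NP n Nn l vl.
by rewrite -xE -kapB.
Qed.

HB.instance Definition _ := Uniform_isComplete.Build interp
  (@sequentially_complete R k interp interp_complete).

(** * Truncations and the boundedly complete basis *)

Lemma trunc_trunc p q n a : (q <= n)%N -> trunc p q (trunc 0 n a) = trunc p q a.
Proof.
move=> qn; apply/funext => i; rewrite /trunc; case: ifP => // /andP[_ iq].
by rewrite (leq_trans iq qn).
Qed.

Lemma trunc0 n m a : (m <= n)%N -> trunc n m a = 0.
Proof.
move=> mn; apply/funext => i; rewrite /trunc; case: ifP => // /andP[ni im].
by have := leq_ltn_trans (leq_trans mn ni) im; rewrite ltnn.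
Qed.

Lemma trunc_cat n m a : (n <= m)%N -> trunc 0 m a = trunc 0 n a + trunc n m a.
Proof.
move=> nm; apply/funext => i.
rewrite -[(trunc 0 n a + trunc n m a) i]/(trunc 0 n a i + trunc n m a i) /trunc leq0n /=.
have [ni|ni] /= := ltnP i n; first by rewrite (leq_trans ni nm) addr0.
by rewrite add0r.
Qed.

Lemma trunc1 n a : trunc n n.+1 a = a n *: delta n.
Proof.
apply/funext => i; rewrite /trunc -[RHS]/(a n * delta n i) /delta ltnS -eqn_leq eq_sym.
by case: eqP => [->|_]; rewrite ?mulr1 ?mulr0.
Qed.

Lemma kap_eventually l : exists M, forall m a, (M <= m)%N ->
  kap l (trunc 0 m a) = kap l a.
Proof.
exists (\max_(s <- l) s.2) => m a Mm; rewrite /kap big_seq [RHS]big_seq.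
apply: eq_bigr => s sl; congr (_ * _); rewrite /pval !big_nat;
  apply: eq_bigr => i /andP[_ is2].
rewrite /trunc /= (leq_trans is2)// (leq_trans _ Mm)//.
exact: (@leq_bigmax_seq _ _ xpredT (fun s => s.2)).
Qed.

Lemma sum_block (P : nat -> nat) N n : (forall i, (P i <= P i.+1)%N) ->
  (\sum_(i < N) (P i <= n < P i.+1)%N <= 1)%N.
Proof.
move=> Pi; have Pm : {homo P : i j / (i <= j)%N} by apply: homo_leq;
  [exact: leqnn|exact: leq_trans|].
apply: (@sum_uniq (fun i => P i <= n < P i.+1)%N) => i j /andP[i1 i2] /andP[j1 j2].
apply/eqP; rewrite eqn_leq; apply/andP; split; rewrite leqNgt; apply/negP => h.
  by have := leq_trans (Pm _ _ h) i1; rewrite leqNgt j2.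
by have := leq_trans (Pm _ _ h) j1; rewrite leqNgt i2.
Qed.

(* This lower 2-estimate is what makes the unit vectors boundedly complete. *)
Lemma valid_join (P : nat -> nat) (L : nat -> seq piece) Q : (0 < Q)%N ->
  (forall i, (P i <= P i.+1)%N) -> (forall i, valid (L i)) ->
  exists2 l, valid l & forall a,
    kap l a = \sum_(i < Q * Q) ofR k Q%:R^-1 * kap (L i) (trunc (P i) (P i.+1) a).
Proof.
move=> Q0 Pi vL.
have Qp : 0 < Q%:R :> R by rewrite ltr0n.
(* Q^2 blocks of weight 1/Q keep the sum of squares at most 1, while Q^2 values e add up to Q e. *)
pose B i := scale_pieces (ofR k Q%:R^-1) (restr (P i) (P i.+1) (L i)).
exists (flatten [seq B i | i <- iota 0 (Q * Q)]); last first.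
  move=> a; rewrite /kap big_flatten big_map -{1}[(Q * Q)%N]subn0 -/(index_iota _ _) big_mkord.
  by apply: eq_bigr => i _; rewrite -[LHS]/(kap (B i) a) kap_scale kap_restr.
split.
- move=> s /flattenP[_ /mapP[i _ ->]] sB.
  have : valid (B i).
    apply: valid_scale; last exact: valid_restr.
    by rewrite nrm_ofR ger0_norm ?invr_ge0 ?ler0n// invf_le1// ler1n.
  by case=> h _ _; exact: h.
- rewrite big_flatten big_map -{1}[(Q * Q)%N]subn0 -/(index_iota _ _) big_mkord.
  apply: (@le_trans _ _ (\sum_(i < Q * Q) (Q%:R * Q%:R)^-1)).
    apply: ler_sum => i _; rewrite !big_map; have [_ h _] := vL i.
    under eq_bigr =>
      s _ do rewrite /cf /= nrmM nrm_ofR ger0_norm ?invr_ge0 ?ler0n// exprMn.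
    rewrite -mulr_sumr invfM -expr2 ler_piMr// sqr_ge0.
  by rewrite sumr_const card_ord -[_ *+ (Q * Q)]mulr_natr natrM mulVf// mulf_neq0 ?gt_eqF.
- move=> n;
  rewrite big_flatten big_map -{1}[(Q * Q)%N]subn0 -/(index_iota _ _) big_mkord.
  apply: leq_trans (sum_block (Q * Q) n Pi); apply: leq_sum => i _.
  have -> : (\sum_(s <- B i) inp s n =
    \sum_(s <- L i) ((P i <= n < P i.+1) && inp s n))%N.
    by rewrite !big_map; apply: eq_bigr => s _; rewrite -inp_restr.
  case: (P i <= n < P i.+1)%N => /=; first by have [_ _ h] := vL i; exact: h.
  by rewrite big1.
Qed.

(** Otherwise there are successive blocks with functionals of value above e; joining Q^2 of them
    gives a value above Q e > B on a truncation of a. *)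
Lemma trunc_tail a B e : (forall m, kap_bounded (trunc 0 m a) B) -> 0 < e ->
  exists n, forall m, kap_bounded (trunc n m a) e.
Proof.
move=> aB e0; apply: contrapT => /forallNP h.
have /choice[g gP] : forall n, exists ml : nat * seq piece,
    [/\ valid ml.2, (n <= ml.1)%N & e < toR (kap ml.2 (trunc n ml.1 a))].
  move=> n; have /existsNP[m /existsNP[l /not_implyP[vl /negP]]] := h n.
  rewrite -ltNge => hl; have [u u1 ul] := rotation (kap l (trunc n m a)).
  exists (m, scale_pieces u l); split=> /=.
  - by apply: valid_scale => //; rewrite u1.
  - rewrite leqNgt; apply/negP => mn; move: hl.
    by rewrite trunc0 ?(ltnW mn)// kap0 nrm0 ltNge (ltW e0).
  - by rewrite kap_scale ul toRK.
pose P := fix P i := if i is j.+1 then (g (P j)).1 else 0%N.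
have Pi i : (P i <= P i.+1)%N by have [] := gP (P i).
pose Q := (Num.truncn (B / e)).+1.
have [||i|l vl lE] := @valid_join P (fun i => (g (P i)).2) Q => //.
  by have [] := gP (P i).
have := aB (P (Q * Q)%N) l vl; apply/negP; rewrite -ltNge.
apply: lt_le_trans (toR_le_nrm _);
  rewrite lE (big_morph (@toR R k) (@toRD R k) (toR0 R k)).
apply: (@lt_le_trans _ _ (\sum_(i < Q * Q) Q%:R^-1 * e)); last first.
  apply: ler_sum => i _; rewrite toRZ ler_wpM2l ?invr_ge0 ?ler0n// trunc_trunc.
    by have [_ _ /ltW] := gP (P i).
  have Pm : {homo P : i j / (i <= j)%N} by apply: homo_leq;
    [exact: leqnn|exact: leq_trans|].
  exact: Pm.
rewrite sumr_const card_ord -[_ *+ (Q * Q)]mulr_natr natrM mulrAC mulrA mulVf ?gt_eqF ?ltr0n// mul1r.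
by rewrite -ltr_pdivrMr//; exact: truncnS_gt.
Qed.

Lemma kap_bounded_truncs a B : (forall m, kap_bounded (trunc 0 m a) B) ->
  kap_bounded a B.
Proof. by move=> aB l vl; have [M kM] := kap_eventually l; rewrite -(kM M)//;
  exact: aB. Qed.

Lemma delta_interp n : delta n \in interp_seq.
Proof. by apply/interp_seqP; exists 1; exact: kap_bounded_delta. Qed.

Definition basis n : interp := Interp (delta_interp n).

Lemma basis_nrm n : nrm (basis n) <= 1.
Proof. by apply: nrm_interp_le; exact: kap_bounded_delta. Qed.

Lemma basis_sum N a : (\sum_(i < N) a i *: basis i : interp) =
  trunc 0 N a :> (nat -> K^o).
Proof.
elim: N => [|N IH]; first by rewrite big_ord0 trunc0.
by rewrite big_ord_recr (trunc_cat _ (leqnSn N)) trunc1 -IH.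
Qed.

Lemma trunc_shift m n q a : (n <= m)%N -> trunc m q (trunc n q a) = trunc m q a.
Proof.
move=> nm; apply/funext => i; rewrite /trunc; case: ifP => // /andP[mi ->].
by rewrite (leq_trans nm mi).
Qed.

Lemma basis_cvg (x : interp) : rcvg (fun N => \sum_(i < N) x i *: basis i) x.
Proof.
move=> e e0; have e2 : 0 < e / 2 by lra.
have [n nP] := trunc_tail (fun m => kap_bounded_trunc 0 m (kap_nrm x)) e2.
exists n => N nN; rewrite nrmBC; apply: (@le_lt_trans _ _ (e / 2)); last by lra.
apply: nrm_interp_le => l vl.
have -> : kap l (x - \sum_(i < N) x i *: basis i) = kap l x - kap l (trunc 0 N x).
  by rewrite -basis_sum -kapB.
have [M kM] := kap_eventually l.
rewrite -(kM _ _ (leq_maxl M N)) (trunc_cat _ (leq_maxr M N)) kapD addrAC subrr add0r.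
rewrite -(trunc_shift _ _ nN); apply: kap_bounded_trunc vl; exact: nP.
Qed.

Lemma basis_schauder : schauder_basis basis.
Proof.
move=> x; exists x; split; first exact/rcvg_series/basis_cvg.
move=> a /rcvg_series ax; apply/funext => n; apply/eqP; rewrite eq_sym -subr_eq0.
apply/eqP/(@nrm_eq0 R k K^o)/eqP; rewrite eq_le nrm_ge0 andbT;
  apply/ler_addgt0Pr => e e0.
have [N NP] := ax e e0; have := NP _ (leq_maxl N n.+1); rewrite add0r => /ltW.
apply: le_trans; apply: le_trans (interp_coord _ n).
by rewrite ivalB basis_sum /trunc leq0n leq_maxr.
Qed.

(* Test [a] against the same pieces, with weights proportional to the conjugates
   of the values [pval s a]. *)
Lemma sum_pval_sqr l a : valid l -> kap_bounded a 1 ->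
  \sum_(s <- l) nrm (pval s a) ^+ 2 <= 1.
Proof.
move=> [h1 h2 h3] a1; set S := \sum_(s <- l) _.
rewrite leNgt; apply/negP => S1.
have /choice[u uP] : forall s, exists u : K^o, nrm u = 1 /\ u * pval s a =
  ofR k (nrm (pval s a)).
  by move=> s; have [u u1 us] := rotation (pval s a); exists u.
have S0 : 0 < S by lra.
pose r := Num.sqrt S; have r0 : 0 < r by rewrite sqrtr_gt0; lra.
have rr : r * r = S by rewrite -expr2 sqr_sqrtr//; lra.
(* The weights have square sum 1 and the value at a is S / r = r, so r <= 1, against S > 1. *)
pose l' : seq piece :=
  [seq (ofR k (nrm (pval s a) / r) * u s, fn s, s.1.2, s.2) | s <- l].
have vl' : valid l'.
  split.
  - by move=> _ /mapP[s sl ->] n sn; exact: (h1 s sl n sn).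
  - rewrite big_map; under eq_bigr => s _.
      rewrite /cf /= nrmM nrm_ofR (uP s).1 mulr1 ger0_norm ?divr_ge0 ?nrm_ge0 ?(ltW r0)//.
      rewrite expr_div_n; over.
    by rewrite /= -mulr_suml [r ^+ 2]expr2 rr -/S divff// gt_eqF.
  - by move=> n; rewrite big_map; exact: h3.
have := a1 _ vl'; rewrite /kap big_map.
have -> : \sum_(s <- l) cf (ofR k (nrm (pval s a) / r) * u s, fn s, s.1.2, s.2) *
    pval (ofR k (nrm (pval s a) / r) * u s, fn s, s.1.2, s.2) a = ofR k r.
  transitivity (\sum_(s <- l) ofR k (nrm (pval s a) ^+ 2 / r)).
    apply: eq_bigr => s _; rewrite -[LHS]/(ofR k (nrm (pval s a) / r) * u s * pval s a).
    by rewrite -mulrA (uP s).2 -ofRM mulrAC expr2.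
  rewrite -(big_morph (ofR k) (@ofRD R k) (ofR0 R k)) -mulr_suml -/S -rr mulfK//.
  by rewrite gt_eqF.
by rewrite nrm_ofR ger0_norm ?(ltW r0)//; move: rr; nra.
Qed.

(** * Upper estimate for blocks with rapidly decreasing images in F *)

Section block_sequence.
Variables (v : nat -> nat -> K^o) (P : nat -> nat) (eta : R).
Hypotheses (eta0 : 0 < eta) (Pi : forall i, (P i < P i.+1)%N).
Hypothesis vP : forall i, trunc (P i) (P i.+1) (v i) = v i.
Hypothesis v1 : forall i, kap_bounded (v i) 1.

Let V i := \sum_(P i <= n < P i.+1) v i n *: y n.
Let L i := \sum_(P i <= n < P i.+1) nrm (v i n).

Hypothesis VL : forall i j, (j < i)%N -> nrm (V i) * L j <= eta * eta.

Lemma pval_block s i : pval s (v i) =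
  \sum_(maxn (P i) s.1.2 <= n < minn (P i.+1) s.2) v i n * fn s (y n).
Proof. by rewrite -{1}(vP i) -pval_restr. Qed.

Lemma pval_disjoint s i : (s.2 <= P i)%N || (P i.+1 <= s.1.2)%N -> pval s (v i) = 0.
Proof.
move=> h; rewrite pval_block big_geq//; case/orP: h => h.
  by rewrite (leq_trans (geq_minr _ _))// (leq_trans h)// leq_maxl.
by rewrite (leq_trans (geq_minl _ _))// (leq_trans h)// leq_maxr.
Qed.

Definition covers s i := (s.1.2 <= P i)%N && (P i.+1 <= s.2)%N.

Lemma pval_covers s i : covers s i -> pval s (v i) = fn s (V i).
Proof.
move=> /andP[h1 h2]; rewrite pval_block (maxn_idPl h1) (minn_idPl h2).
by rewrite bop_sum; apply: eq_bigr => n _; rewrite bopZ.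
Qed.

(** The bounds |f| |f (y_n)| <= 1 enter the upper estimate here, summed with the weights |v_i n|. *)
Lemma fn_block l s i : valid l -> s \in l -> covers s i ->
  nrm (fn s) * nrm (fn s (V i)) <= L i.
Proof.
move=> [h _ _] sl /andP[h1 h2]; rewrite bop_sum.
apply: (@le_trans _ _ (nrm (fn s) * \sum_(P i <=
  n < P i.+1) nrm (fn s (v i n *: y n)))).
  by rewrite ler_wpM2l ?nrm_ge0// nrm_sum.
rewrite mulr_sumr /L big_nat [leRHS]big_nat; apply: ler_sum => n /andP[n1 n2].
rewrite bopZ nrmZ mulrCA ler_piMr ?nrm_ge0// h//.
by rewrite /inp (leq_trans h1 n1) (leq_trans n2 h2).
Qed.

Definition bad s i := covers s i && (eta < nrm (fn s (V i))).

(** A value above eta on block j forces |f| eta <= |f| |f (V j)| <= L j. On the later block i this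
    gives |f (V i)| eta <= |V i| L j <= eta^2 by [VL]. *)
Lemma bad_lt l s i j : valid l -> s \in l -> (j < i)%N -> bad s i -> bad s j -> False.
Proof.
move=> vl sl ji /andP[ci bi] /andP[cj bj].
have h1 := nrm_opP (fn s) (V i); have h2 := fn_block vl sl cj.
have h3 := VL ji; have f0 := nrm_ge0 (fn s); have V0 := nrm_ge0 (V i).
have : eta * eta < nrm (fn s) * nrm (V i) * eta.
  by rewrite ltr_pM2r// (lt_le_trans bi).
have : nrm (V i) * (nrm (fn s) * eta) <= nrm (V i) * L j.
  rewrite ler_wpM2l// (le_trans _ h2)// ler_wpM2l// ltW//.
lra.
Qed.

Lemma bad_uniq l s i j : valid l -> s \in l -> bad s i -> bad s j -> i = j.
Proof.
move=> vl sl bi bj; have [ij|ij|//] := ltngtP i j.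
  by case: (bad_lt vl sl ij bj bi).
by case: (bad_lt vl sl ij bi bj).
Qed.

(** A piece that meets block i without covering it has an endpoint strictly inside. Each endpoint is
    inside at most one block and at most one block is bad, whence the 3 in [sum_partial]. *)
Definition partial s i :=
  ((P i < s.1.2 < P i.+1) + (P i < s.2 < P i.+1) + bad s i)%N.

Lemma sum_partial l s N : valid l -> s \in l -> (\sum_(i < N) partial s i <= 3)%N.
Proof.
move=> vl sl; rewrite !big_split/=.
have block x : (\sum_(i < N) (P i < x < P i.+1)%N <= 1)%N.
  apply: leq_trans (sum_block N x (fun i => ltnW (Pi i))).
  apply: leq_sum => i _; have [/andP[h1 h2]|//] := boolP (P i < x < P i.+1)%N.
  by rewrite (ltnW h1) h2.
rewrite (@leq_add _ _ 2 1)//; first by rewrite (@leq_add _ _ 1 1)// block.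
exact: sum_uniq (fun i j => bad_uniq vl sl).
Qed.

Lemma partial_gt0 s i : pval s (v i) != 0 ->
  ~~ (inp s (P i) && (nrm (pval s (v i)) <= eta)) ->
  (0 < partial s i)%N.
Proof.
move=> s0; have : ~~ ((s.2 <= P i) || (P i.+1 <= s.1.2))%N.
  by apply: contra s0 => /pval_disjoint ->.
rewrite negb_or -!ltnNge /partial /bad => /andP[h1 h2].
have [c|] := boolP (covers s i).
  move: (c); rewrite (pval_covers c) => /andP[h3 h4].
  by rewrite /inp h3 h1 /= -ltNge => ->; rewrite addn1.
rewrite /covers negb_and -!ltnNge => /orP[h3|h3] _.
  by rewrite h3 h2.
by rewrite h1 h3 addn1.
Qed.

(** The eta term is charged to a piece containing the first point of the block: there is at most
    one, so summing over the pieces costs eta per block. Other nonzero values have [partial s i] at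
    least 1, and Young's inequality with parameter Q applies. *)
Lemma pval_young l s i Q : valid l -> s \in l -> (0 < Q)%N ->
  nrm (cf s) * nrm (pval s (v i)) <=
  eta * (inp s (P i))%:R +
  (Q%:R * nrm (cf s) ^+ 2 * (partial s i)%:R + nrm (pval s (v i)) ^+ 2 / Q%:R) / 2.
Proof.
move=> vl sl Q0; have Qp : 0 < Q%:R :> R by rewrite ltr0n.
set c := nrm (cf s); set b := nrm (pval s (v i)).
have c0 : 0 <= c by exact: nrm_ge0. have b0 : 0 <= b by exact: nrm_ge0.
have c1 : c <= 1 by exact: valid_cf vl sl.
have h0 : 0 <= Q%:R * c ^+ 2 * (partial s i)%:R.
  by rewrite !mulr_ge0 ?sqr_ge0 ?ler0n.
have h1 : 0 <= b ^+ 2 / Q%:R by rewrite divr_ge0 ?sqr_ge0 ?ler0n.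
have h2 : 0 <= eta * (inp s (P i))%:R by rewrite mulr_ge0 ?ler0n// ltW.
have [p0|p0] := eqVneq (pval s (v i)) 0.
  by rewrite /b p0 nrm0 mulr0; rewrite /b p0 in h1; lra.
have [/andP[-> bs]|ns] := boolP (inp s (P i) && (b <= eta)).
  rewrite mulr1; have : c * b <= 1 * eta by rewrite ler_pM.
  lra.
have p1 : 1 <= (partial s i)%:R :> R by rewrite ler1n partial_gt0.
have h3 : Q%:R * c ^+ 2 * 1 <= Q%:R * c ^+ 2 * (partial s i)%:R.
  by rewrite ler_wpM2l// mulr_ge0 ?sqr_ge0 ?ler0n.
have : c * b <= (Q%:R * c ^+ 2 + b ^+ 2 / Q%:R) / 2.
  rewrite -subr_ge0; have -> : (Q%:R * c ^+ 2 + b ^+ 2 / Q%:R) / 2 - c * b =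
     (Q%:R * c - b) ^+ 2 / Q%:R / 2 by field; rewrite gt_eqF.
  by rewrite !divr_ge0// ?sqr_ge0// ler0n.
lra.
Qed.

(* Split [kap l (v i)] over pieces: the pieces covering the block with small
   value contribute [eta] once per block, and every piece is exceptional for at
   most three blocks, where Young's inequality applies. *)
Lemma kap_bounded_blocks Q : (0 < Q)%N ->
  kap_bounded (\sum_(i < Q * Q) v i) (2 * Q%:R + eta * (Q * Q)%:R).
Proof.
move=> Q0 l vl; have Qp : 0 < Q%:R :> R by rewrite ltr0n.
have [_ c1 in1] := vl.
rewrite kap_sum (le_trans (nrm_sum _ _ _))//.
apply: (@le_trans _ _ (\sum_(i < Q * Q) \sum_(s <- l)
    (eta * (inp s (P i))%:R + (Q%:R * nrm (cf s) ^+ 2 * (partial s i)%:R +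
      nrm (pval s (v i)) ^+ 2 / Q%:R) / 2))).
  apply: ler_sum => i _; rewrite (le_trans (nrm_sum _ _ _))//.
  rewrite big_seq [leRHS]big_seq; apply: ler_sum => s sl.
  by rewrite nrmM; exact: (pval_young i vl sl Q0).
under eq_bigr => i _ do rewrite big_split -mulr_sumr -mulr_suml big_split -mulr_suml.
rewrite big_split -mulr_sumr -mulr_suml big_split -mulr_suml /=.
(* The three sums contribute at most eta Q^2, 3 Q / 2 and Q / 2. *)
have h1 : \sum_(i < Q * Q) \sum_(s <- l) (inp s (P i))%:R <= (Q * Q)%:R :> R.
  rewrite -[X in _ <= X%:R]card_ord -sumr_const; apply: ler_sum => i _.
  by have := in1 (P i); rewrite -(ler_nat R) natr_sum.
have h2 : \sum_(i < Q * Q) \sum_(s <- l) Q%:R * nrm (cf s) ^+ 2 * (partial s i)%:R <= 3 * Q%:R :> R.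
  rewrite exchange_big/=.
  apply: (@le_trans _ _ (\sum_(s <- l) Q%:R * nrm (cf s) ^+ 2 * 3)).
    rewrite big_seq [leRHS]big_seq; apply: ler_sum => s sl.
    have := sum_partial (Q * Q) vl sl; rewrite -(ler_nat R) natr_sum => h.
    by rewrite -mulr_sumr; apply: ler_wpM2l h; rewrite mulr_ge0 ?sqr_ge0 ?ler0n.
  by rewrite -mulr_suml -mulr_sumr; nra.
have h3 : \sum_(i < Q * Q) \sum_(s <- l) nrm (pval s (v i)) ^+ 2 <= (Q * Q)%:R :> R.
  rewrite -[X in _ <= X%:R]card_ord -sumr_const; apply: ler_sum => i _.
  exact: sum_pval_sqr.
have h4 : (\sum_(i < Q * Q) \sum_(s <- l) nrm (pval s (v i)) ^+ 2) / Q%:R <= Q%:R.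
  by rewrite ler_pdivrMr// -natrM.
by have := ler_wpM2l (ltW eta0) h1; lra.
Qed.

End block_sequence.

Lemma truncD p q a b : trunc p q (a + b) = trunc p q a + trunc p q b.
Proof.
apply/funext => i; rewrite -[RHS]/(trunc p q a i + trunc p q b i) /trunc.
by case: ifP => // _; rewrite addr0.
Qed.

Lemma truncZ p q (c : K^o) a : trunc p q (c *: a) = c *: trunc p q a.
Proof.
apply/funext => i; rewrite -[RHS]/(c * trunc p q a i) /trunc.
by case: ifP => // _; rewrite mulr0.
Qed.

Lemma trunc_widen p q m a : (q <= m)%N -> trunc p q a = a -> trunc p m a = a.
Proof.
move=> qm aE; apply/funext => i; rewrite -aE /trunc.
case: ifP => // h; case: ifP => // /andP[pi iq].
by rewrite pi (leq_trans iq qm) in h.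
Qed.

Lemma trunc_shrink p r m a : (p <= r)%N -> trunc r m a = a -> trunc p m a = a.
Proof.
move=> pr aE; apply/funext => i; rewrite -aE /trunc.
case: ifP => // h; case: ifP => // /andP[pi iq].
by rewrite iq (leq_trans pr pi) in h.
Qed.

Lemma sum_trunc p q m a : (q <= m)%N -> trunc p q a = a ->
  \sum_(n < m) a n *: y n = \sum_(p <= n < q) a n *: y n.
Proof.
move=> qm aE; rewrite (big_nat_ord p _ qm); apply: eq_bigr => i _.
by rewrite -{1}aE /trunc; case: ifP => // _; rewrite scale0r.
Qed.

Lemma ival_sum (x : nat -> interp) N :
  (\sum_(i < N) x i : interp) = \sum_(i < N) (x i : nat -> K^o) :> (nat -> K^o).
Proof.
elim: N => [|N IH]; first by rewrite !big_ord0.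
by rewrite big_ord_recr [in RHS]big_ord_recr -IH.
Qed.

(* Were a functional at least [e] on normalized vectors supported arbitrarily far
   out, Mazur's theorem would give such blocks [v_i] whose images in [F] decrease
   fast, and the norm of [v_0 + ... + v_(Q^2 - 1)] is only of order [Q]. *)
Lemma shrinking (f : dual interp) e : 0 < e -> exists p, forall (v : interp) m,
  trunc p m v = v -> nrm v <= 1 -> nrm (f v) <= e.
Proof.
move=> e0; apply: contrapT => /forallNP far.
pose C p (v : interp) m := [/\ trunc p m v = v, nrm v <= 1 & e <= toR (f v)].
have C1 p : exists v m, C p v m.
  have /existsNP[v /existsNP[m /not_implyP[vE /not_implyP[v1 /negP]]]] := far p.
  rewrite -ltNge => fv; have [u u1 uf] := rotation (f v).
  exists (u *: v), m; split; last by rewrite bopZ -[_ *: f v]/(u * f v) uf toRK ltW.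
    by rewrite -[ival (u *: v)]/(u *: (v : nat -> K^o)) truncZ vE.
  by rewrite nrmZ u1 mul1r.
(* The images in F of such vectors form a convex set that comes close to 0. Otherwise Mazur's
   theorem gives g with real part at least d on it, and a multiple of g, valid far out since g (y_n)
   tends to 0, exceeds 1 on a vector of norm at most 1. *)
have C2 p d : 0 < d -> exists v m, [/\ C p v m, (p < m)%N &
    nrm (\sum_(p <= n < m) v n *: y n) < d].
  move=> d0; apply: contrapT => small.
  pose D := [set z | exists v m, C p v m /\ z = \sum_(n < m) v n *: y n].
  have CD v m M : C p v m -> (m <= M)%N ->
      C p v M /\ \sum_(n < m) v n *: y n = \sum_(n < M) v n *: y n.
    move=> [h1 h2 h3] mM; split; first by split=> //; exact: trunc_widen h1.
    by rewrite (sum_trunc (leqnn m) h1) (sum_trunc mM h1).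
  have [||g g1 gD] := @mazur _ _ _ D d.
  - move=> _ _ s t [v [m [/CD vm ->]]] [w [n [/CD wn ->]]] s0 t0 st.
    have [[v1 v2 v3] ->] := vm _ (leq_maxl m n).
    have [[w1 w2 w3] ->] := wn _ (leq_maxr m n).
    exists (ofR k s *: v + ofR k t *: w), (maxn m n); split; last first.
      rewrite !scaler_sumr -big_split; apply: eq_bigr => i _.
      by rewrite /= !scalerA -scalerDl.
    split.
    + rewrite -[ival _]/(ofR k s *: (v : nat -> K^o) + ofR k t *: (w : nat -> K^o)).
      by rewrite truncD !truncZ v1 w1.
    + rewrite (le_trans (nrmD _ _))// !nrmZ !nrm_ofR !ger0_norm//; nra.
    + rewrite bopD !bopZ toRD -[_ *: f v]/(ofR k s * f v) -[_ *: f w]/(ofR k t * f w).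
      by rewrite !toRZ; nra.
  - move=> _ [v [m [vm ->]]]; rewrite leNgt; apply/negP => hv; apply: small.
    (* The support bound is moved past p, so that the block [p, m) is nonempty. *)
    have [vM vmE] := CD _ _ (maxn m p.+1) vm (leq_maxl _ _).
    exists v, (maxn m p.+1); split=> //; first exact: leq_maxr.
    by have [h _ _] := vM; rewrite -(sum_trunc (leqnn _) h) -vmE.
  (* The piece t g takes a value of modulus at least t d = 2, and it is valid where |g (y_n)| <
     t^-2, because |g| <= 1. *)
  pose t := 2 / d; have t0 : 0 < t by rewrite divr_gt0.
  have tt0 : 0 < (t * t)^-1 by rewrite invr_gt0 mulr_gt0.
  have [N NP] := uw_null y g tt0.
  have [v [m vm]] := C1 (maxn p N).
  have [v1 v2 v3] := vm.
  have vD : D (\sum_(n < m) v n *: y n).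
    exists v, m; split=> //; split=> //; exact: trunc_shrink (leq_maxl _ _) v1.
  have := gD _ vD; rewrite (sum_trunc (leqnn m) v1) => hd.
  have vl : valid [:: (1, ofR k t *: g, maxn p N, m)].
    apply: valid1 => n /andP[pn _].
    rewrite -[(ofR k t *: g) (y n)]/(ofR k t *: g (y n)) !nrmZ !nrm_ofR (gtr0_norm t0).
    have gn : nrm g <= 1 by apply: nrm_op_le => // x; rewrite mul1r.
    have := NP n (leq_trans (leq_maxr _ _) pn); rewrite subr0 /= => gy.
    rewrite mulrACA; have : nrm g * nrm (g (y n)) <= 1 * (t * t)^-1.
      by rewrite ler_pM ?nrm_ge0// ltW.
    have tt : 0 < t * t by rewrite mulr_gt0.
    by move=> /(ler_wpM2l (ltW tt)); rewrite mul1r divff// gt_eqF.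
  have := kap_nrm v vl; rewrite kap1.
  set z := \sum_(_ <= _ < _) _ in hd *.
  rewrite -[(ofR k t *: g) z]/(ofR k t *: g z) nrmZ nrm_ofR (gtr0_norm t0) => h.
  have := toR_le_nrm (g z); have td : t * d = 2 by rewrite /t divfK// gt_eqF.
  nra.
(* The sum z of Q^2 blocks satisfies Q^2 e <= |f z| <= 3 Q |f|, against Q e > 3 |f|. Taking eta = 1
   / Q makes eta Q^2 = Q in [kap_bounded_blocks]. *)
pose Q := (Num.truncn (3 * nrm f / e)).+1.
have Q0 : 0 < Q%:R :> R by rewrite ltr0n.
pose eta : R := Q%:R^-1; have eta0 : 0 < eta by rewrite invr_gt0.
have d0 (L : R) : 0 < eta * eta / (1 + `|L|).
  by rewrite divr_gt0 ?mulr_gt0// ltr_pwDl.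
have /choice[g gP] : forall pL : nat * R, exists vm : interp * nat,
    [/\ C pL.1 vm.1 vm.2, (pL.1 < vm.2)%N &
     nrm (\sum_(pL.1 <= n < vm.2) vm.1 n *: y n) < eta * eta / (1 + `|pL.2|)].
  by move=> [p L]; have [v [m h]] := C2 p _ (d0 L); exists (v, m).
pose L1 (a : nat -> K^o) p q := \sum_(p <= n < q) nrm (a n).
(* The state holds the start of the next block and the total l_1 norm of the earlier blocks, which
   bounds each of them in [VL]. *)
pose st := fix st i : nat * R := if i is j.+1 then
  ((g (st j)).2, (st j).2 + L1 (g (st j)).1 (st j).1 (g (st j)).2) else (0%N, 0).
pose v i := (g (st i)).1; pose P i := (st i).1.
have Pi i : (P i < P i.+1)%N by have [] := gP (st i).
have L10 a p q : 0 <= L1 a p q by apply: sumr_ge0 => *; exact: nrm_ge0.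
have st0 i : 0 <= (st i).2 by elim: i => //= i IH; exact: addr_ge0.
have stL i j : (j < i)%N -> L1 (v j) (P j) (P j.+1) <= (st i).2.
  elim: i => // i IH; rewrite ltnS leq_eqVlt => /predU1P[->|/IH h] /=.
    by rewrite lerDr.
  by rewrite (le_trans h)// lerDl.
have vP i : trunc (P i) (P i.+1) (v i) = v i by have [[]] := gP (st i).
have v1 i : kap_bounded (v i) 1.
  by move=> l vl; have [[_ h _] _ _] := gP (st i); exact: le_trans (kap_nrm _ vl) h.
have fv i : e <= toR (f (v i)) by have [[]] := gP (st i).
have VL i j : (j < i)%N ->
    nrm (\sum_(P i <= n < P i.+1) v i n *: y n) * L1 (v j) (P j) (P j.+1) <= eta * eta.
  move=> /stL h; have [_ _ /ltW hV] := gP (st i).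
  apply: (@le_trans _ _ (eta * eta / (1 + `|(st i).2|) * (st i).2)).
    by apply: ler_pM => //; exact: nrm_ge0.
  have s0 := st0 i; rewrite ger0_norm// mulrAC ler_pdivrMr; last by lra.
  by rewrite ler_wpM2l ?mulr_ge0 ?(ltW eta0)//; lra.
have hz := kap_bounded_blocks eta0 Pi vP v1 VL (ltn0Sn _ : (0 < Q)%N).
pose z : interp := \sum_(i < Q * Q) v i.
have zQ : nrm z <= 3 * Q%:R.
  apply: nrm_interp_le => l vl; rewrite ival_sum (le_trans (hz l vl))//.
  rewrite natrM mulrA mulVf ?gt_eqF// mul1r; lra.
have fz : (Q%:R * Q%:R) * e <= nrm (f z).
  apply: le_trans (toR_le_nrm _);
    rewrite bop_sum (big_morph (@toR R k) (@toRD R k) (toR0 R k)).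
  apply: (@le_trans _ _ (\sum_(i < Q * Q) e)); last by apply: ler_sum => i _; exact: fv.
  by rewrite sumr_const card_ord -[_ *+ (Q * Q)]mulr_natl natrM.
have fQ : 3 * nrm f < Q%:R * e by rewrite -ltr_pdivrMr//; exact: truncnS_gt.
have := nrm_opP f z; have := ler_wpM2l (nrm_ge0 f) zQ; nra.
Qed.

Lemma basis_wnull : wnull basis.
Proof.
move=> f e e0; have e2 : 0 < e / 2 by lra.
have [p fp] := shrinking f e2; exists p => n pn; rewrite subr0 /=.
suff : nrm (f (basis n)) <= e / 2 by lra.
apply: (fp _ n.+1); last exact: basis_nrm.
apply/funext => i; rewrite /trunc -[ival (basis n) i]/(delta n i) /delta.
case: eqVneq => [->|_]; first by rewrite pn ltnSn.
by case: ifP.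
Qed.

Lemma kap_trunc l m a : kap l (trunc 0 m a) = \sum_(n < m) a n * kap l (delta n).
Proof.
elim: m => [|m IH]; first by rewrite big_ord0 trunc0// kap0.
by rewrite big_ord_recr (trunc_cat _ (leqnSn m)) kapD IH trunc1 kapZ.
Qed.

(** James's argument. The values of phi on the coordinate functionals form a sequence of finite
    norm, hence a vector x. As the basis is shrinking, f is the norm limit of its truncations
    [fm m], and phi sends these to f of the partial sums of x, which converge to x. *)
Lemma interp_reflexive : reflexive_space interp.
Proof.
move=> phi.
have /choice[ec ecE] : forall n, exists c : dual interp, forall x, c x = x n.
  move=> n; apply: (@make_op R k interp K^o (fun x : interp => x n) 1) => [//|x].
  by rewrite mul1r interp_coord.
pose a n : K^o := phi (ec n).
have [|x xE] := @make_interp a (nrm phi).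
  apply: kap_bounded_truncs => m l vl.
  (* [kap l] cut to the first m coordinates has norm at most 1 and is a combination of coordinate
     functionals, on which phi is known. *)
  pose h : dual interp := \sum_(n < m) (kap l (delta n) : K) *: ec n.
  have hE x : h x = kap l (trunc 0 m x).
    rewrite /h (@bop_sumE R k interp K^o (fun n =>
      (kap l (delta n) : K) *: ec n)) kap_trunc.
    apply: eq_bigr => n _.
    by rewrite -[LHS]/(kap l (delta n) * ec n x) ecE mulrC.
  have -> : kap l (trunc 0 m a) = phi h.
    rewrite kap_trunc /h bop_sum; apply: eq_bigr => n _.
    by rewrite bopZ -[RHS]/(kap l (delta n) * a n) mulrC.
  apply: le_trans (nrm_opP phi h) _; rewrite ler_piMr ?nrm_ge0//.
  apply: nrm_op_le => // x; rewrite mul1r hE.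
  exact: (kap_bounded_trunc 0 m (kap_nrm x)).
exists x => f.
pose fm m : dual interp := \sum_(n < m) (f (basis n) : K) *: ec n.
have fmE m z : fm m z = f (\sum_(n < m) z n *: basis n).
  rewrite /fm (@bop_sumE R k interp K^o (fun n => (f (basis n) : K) *: ec n)) bop_sum.
  apply: eq_bigr => n _; rewrite bopZ.
  by rewrite -[LHS]/(f (basis n) * ec n z) ecE mulrC.
have phifm m : phi (fm m) = f (\sum_(n < m) x n *: basis n).
  rewrite /fm !bop_sum; apply: eq_bigr => n _; rewrite !bopZ xE.
  by rewrite -[LHS]/(f (basis n) * a n) mulrC.
(* f - fm m is f applied to the tail beyond m, which [shrinking] makes uniformly small on the unit
   ball. *)
have fmf e : 0 < e -> exists p, forall m, (p <= m)%N -> nrm (f - fm m) < e.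
  move=> e0; have e2 : 0 < e / 2 by lra.
  have [p fp] := shrinking f e2; exists p => m pm.
  apply: (@le_lt_trans _ _ (e / 2)); last by lra.
  apply: nrm_op_sup => z z1; apply/ler_addgt0Pr => d d0.
  rewrite -[(f - fm m) z]/(f z - fm m z) fmE.
  have [M MP] := rcvg_op f (basis_cvg z) d0.
  pose M' := maxn M m; have := MP M' (leq_maxl _ _); rewrite /= nrmBC.
  set u := \sum_(n < M') z n *: basis n; set w := \sum_(n < m) z n *: basis n.
  have uw : ival (u - w) = trunc m M' z.
    rewrite -[ival (u - w)]/((u : nat -> K^o) - (w : nat -> K^o)) !basis_sum.
    by rewrite (trunc_cat _ (leq_maxr M m)) addrAC subrr add0r.
  have : nrm (f (u - w)) <= e / 2.
    apply: (fp _ M').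
      by rewrite uw; apply: (@trunc_shrink _ m) => //; exact: trunc_shift.
    apply: le_trans z1; apply: nrm_interp_le; rewrite uw.
    exact: kap_bounded_trunc (kap_nrm z).
  by rewrite bopB; have := nrm_tri (f z) (f u) (f w); lra.
apply: (@rcvg_unique R k K^o (fun m => phi (fm m))).
  move=> e e0; have p0 := nrm_ge0 phi; have p1 : 0 < nrm phi + 1 by lra.
  have [p pP] := fmf _ (divr_gt0 e0 p1); exists p => m /pP h.
  rewrite nrmBC -bopB; have := nrm_opP phi (f - fm m).
  have : (nrm phi + 1) * nrm (f - fm m) < e by rewrite mulrC -ltr_pdivlMr.
  have := nrm_ge0 (f - fm m); rewrite mulrDl mul1r; lra.
apply: rcvg_ext phifm _; exact: rcvg_op (basis_cvg x).
Qed.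

(** * The diagonal operator *)

Definition lam n : R := 1 - halfX n.+1.

Definition wsum M a := \sum_(n < M) (ofR k (lam n) * a n) *: y n.

Lemma sum_halfXS n : \sum_(i < n) halfX i.+1 = 1 - halfX n.
Proof.
under eq_bigr => i _ do rewrite halfXS.
by rewrite -mulr_suml sum_halfX; lra.
Qed.

(** Summation by parts: [lam n] is the sum of 2^-(i+1) over i <= n, so the weighted sum averages the
    sums over [i, M). *)
Lemma wsumE M a : wsum M a =
  \sum_(i < M) ofR k (halfX i.+1) *: \sum_(i <= n < M) a n *: y n.
Proof.
rewrite /wsum; elim: M => [|M IH]; first by rewrite !big_ord0.
rewrite big_ord_recr IH /=.
transitivity (\sum_(i < M.+1) (ofR k (halfX i.+1) *: (\sum_(i <= n < M) a n *: y n) +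
    ofR k (halfX i.+1) *: (a M *: y M))).
  rewrite big_split/= big_ord_recr/= [\sum_(M <= n < M) _]big_geq// scaler0 addr0.
  congr (_ + _); rewrite -scaler_suml -(big_morph (ofR k) (@ofRD R k) (ofR0 R k)).
  by rewrite sum_halfXS -scalerA.
by apply: eq_bigr => i _; rewrite -scalerDr big_nat_recr//= -ltnS.
Qed.

Lemma wsum_le M a (c : nat -> R) :
  (forall i, nrm (\sum_(i <= n < M) a n *: y n) <= c i) ->
  nrm (wsum M a) <= \sum_(i < M) halfX i.+1 * c i.
Proof.
move=> ac; rewrite wsumE (le_trans (nrm_sum _ _ _))//; apply: ler_sum => i _.
by rewrite nrmZ nrm_ofR gtr0_norm ?halfX_gt0// ler_wpM2l// ltW ?halfX_gt0.
Qed.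

Lemma wsum_bounded M a B : kap_bounded a B -> nrm (wsum M a) <= B.
Proof.
move=> aB; have B0 : 0 <= B by apply: le_trans (aB _ valid_nil); exact: nrm_ge0.
apply: le_trans (@wsum_le M a (fun=> B) _) _; first by move=> i; exact: kap_bounded_vec.
by rewrite -mulr_suml sum_halfXS; have := halfX_gt0 R M; nra.
Qed.

Lemma sum_halfX_lt p M : \sum_(i < M) halfX i.+1 * (i < p)%N%:R = 1 - halfX (minn M p).
Proof.
elim: M => [|M IH]; first by rewrite big_ord0 min0n /halfX expr0 subrr.
rewrite big_ord_recr/= IH; have [Mp|pM] := ltnP M p.
  by rewrite (minn_idPl Mp) halfXS mulr1; lra.
by rewrite (minn_idPr (leqW pM)) mulr0 addr0.
Qed.

(* The tails beyond [p] contribute only half as much. *)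
Lemma wsum_strict M a B p : kap_bounded a B ->
  (forall m, kap_bounded (trunc p m a) (B / 2)) ->
  nrm (wsum M a) <= B - halfX p * (B / 2).
Proof.
move=> aB aB2; have B0 : 0 <= B by apply: le_trans (aB _ valid_nil); exact: nrm_ge0.
apply: le_trans (@wsum_le M a (fun i => B / 2 + (i < p)%N%:R * (B / 2)) _) _.
  move=> i; have [ip|pi] := ltnP i p; first by rewrite mul1r;
    have := kap_bounded_vec i M aB; lra.
  rewrite mul0r addr0.
  have -> : \sum_(i <= n < M) a n *: y n = \sum_(i <= n < M) trunc p M a n *: y n.
    rewrite !big_nat; apply: eq_bigr => n /andP[ni nM].
    by rewrite /trunc (leq_trans pi ni) nM.
  exact: kap_bounded_vec.
under eq_bigr => i _ do rewrite mulrDr (mulrA _ (i < p)%N%:R).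
rewrite big_split/= -!mulr_suml sum_halfX_lt sum_halfXS.
have h1 : halfX p <= halfX (minn M p) by apply: halfX_anti; exact: geq_minr.
have := halfX_gt0 R M; nra.
Qed.

Lemma wsumD M (c : K^o) a b : wsum M (c *: a + b) = c *: wsum M a + wsum M b.
Proof.
rewrite scaler_sumr -big_split; apply: eq_bigr => i _.
by rewrite /= scalerA -scalerDl mulrDr mulrCA.
Qed.

Lemma wsum_trunc m M a : (m <= M)%N -> wsum M a - wsum m a = wsum M (trunc m M a).
Proof.
move=> mM.
have -> : wsum m a = wsum M (trunc 0 m a).
  rewrite /wsum (big_ord_widen M (fun n =>
    (ofR k (lam n) * a n) *: y n) mM) big_mkcond/=.
  by apply: eq_bigr => i _; rewrite /trunc /=; case: ifP => // _; rewrite mulr0 scale0r.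
have {1}-> : wsum M a = wsum M (trunc 0 M a).
  by apply: eq_bigr => i _; rewrite /trunc ltn_ord.
have -> : trunc 0 M a = 1 *: trunc 0 m a + trunc m M a by rewrite scale1r -trunc_cat.
by rewrite wsumD scale1r addrAC subrr add0r.
Qed.

(** The gap in the strict inequality is 2^-p |x| / 2, where p is a point beyond which the
    truncations of x have norm at most |x| / 2. It depends on x, which leaves room for |T| = 1. *)
Lemma diagonal_operator : exists T : bounded_op interp F,
  (forall n, T (basis n) = ofR k (lam n) *: y n) /\
  (forall x, x != 0 -> nrm (T x) < nrm x).
Proof.
have tails (x : interp) e : 0 < e -> exists p, forall m, kap_bounded (trunc p m x) e.
  move=> e0; apply: trunc_tail e0 => m; exact: (kap_bounded_trunc 0 m (kap_nrm x)).
have /choice[T TP] : forall x : interp, exists z, rcvg (fun M => wsum M x) z.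
  move=> x; apply: complete_rcvg => e e0; have e2 : 0 < e / 2 by lra.
  have [p pP] := tails x _ e2.
  have near m M : (p <= m)%N -> (m <= M)%N -> nrm (wsum M x - wsum m x) < e.
    move=> pm mM; rewrite wsum_trunc//; apply: (@le_lt_trans _ _ (e / 2)); last by lra.
    apply: wsum_bounded; rewrite -(trunc_shift _ _ pm); exact: kap_bounded_trunc.
  exists p => m n pm pn; have [mn|nm] := leqP m n; last exact: near pn (ltnW nm).
  by rewrite nrmBC; exact: near.
have Tlin : linear T.
  move=> c x z; apply: rcvg_unique (TP (c *: x + z)) _.
  apply: (@rcvg_ext R k F _ (fun M => c *: wsum M x + wsum M z)) => [M|].
    exact: (wsumD M c x z).
  exact: rcvgD (rcvgZ _ (TP x)) (TP z).
have Tle (x : interp) B : (forall M, nrm (wsum M x) <= B) -> nrm (T x) <= B.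
  move=> xB; apply/ler_addgt0Pr => e /(TP x)[N /(_ N (leqnn _))]; rewrite nrmBC.
  by have := ler_nrmB (T x) (wsum N x); have := xB N; lra.
have [x|T' TE] := make_op Tlin (M := 1).
  by rewrite mul1r; apply: Tle => M; apply: wsum_bounded; exact: kap_nrm.
exists T'; split=> [n|x x0]; rewrite TE.
  apply: rcvg_unique (TP _) _ => e e0; exists n.+1 => M nM.
  rewrite /wsum (bigD1 (Ordinal nM))//= big1 => [|i].
    rewrite addr0 /delta eqxx mulr1 subrr nrm0.
    exact: e0.
  rewrite -val_eqE /= => /negbTE ni; rewrite /delta ni.
  by rewrite mulr0 scale0r.
have nx := nrm_gt0 x0; have nx2 : 0 < nrm x / 2 by lra.
have [p pP] := tails x _ nx2.
apply: (@le_lt_trans _ _ (nrm x - halfX p * (nrm x / 2))).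
  by apply: Tle => M; apply: wsum_strict pP; exact: kap_nrm.
by have := halfX_gt0 R p; nra.
Qed.

End interpolation_space.

(** * Spaces without the Schur property *)

Section converse.
Variables (R : realType) (k : scalar_kind).
Local Notation K := (scalar_field R k).
Local Notation halfX := (@halfX R).

Lemma not_schur_unit_wnull (F : completeNormedModType K) :
  ~ schur_property F -> exists y : unit_wnull F, True.
Proof.
move=> /existsNP[x /existsNP[l /not_implyP[/weakly_cvgP wx xl]]].
have /existsNP[e /not_implyP[e0 xe]] : ~ rcvg x l.
  by move=> /rcvgP h; apply: xl; apply/cvg_ex; exists l.
have [|s sincr sP] := @infinite_subsequence (fun n => e <= nrm (x n - l)).
  move=> N; apply: contrapT => h; apply: xe; exists N => n Nn; rewrite ltNge.
  by apply/negP => hn; apply: h; exists n.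
pose w n := x (s n) - l.
have wl : wnull w := wnull_sub (increasing_ge sincr) wx.
have w0 n : 0 < nrm (w n) by apply: lt_le_trans (sP n).
pose y n := ofR k (nrm (w n))^-1 *: w n.
have y1 n : nrm (y n) = 1.
  by rewrite nrmZ nrm_ofR gtr0_norm ?invr_gt0// mulVf// gt_eqF.
suff yl : wnull y by exists (UnitWnull y1 yl).
move=> f d d0; have [N NP] := wl f _ (mulr_gt0 e0 d0); exists N => n /NP.
rewrite !subr0 /= bopZ nrmZ nrm_ofR gtr0_norm ?invr_gt0// => h.
rewrite mulrC ltr_pdivrMr// (lt_le_trans h)// mulrC ler_wpM2l ?(ltW d0)//.
exact: sP.
Qed.

Lemma schur_counterexample (F : completeNormedModType K) : ~ schur_property F ->
  exists G : completeNormedModType K, [/\ reflexive_space G, has_schauder_basis G &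
    exists T : bounded_op G F, ~ ccont T /\ ~ norm_attaining_ops G F T].
Proof.
move=> /not_schur_unit_wnull[y _].
exists (interp y : completeNormedModType K); split.
- exact: interp_reflexive.
- exists (@basis R k F y); exact: basis_schauder.
have [T [Tb Tx]] := diagonal_operator y.
have Tn n : nrm (T (basis y n)) = 1 - halfX n.+1.
  rewrite Tb nrmZ uw_nrm mulr1 nrm_ofR ger0_norm// /lam halfXS.
  by have := halfX_le1 R n; have := halfX_gt0 R n; lra.
exists T; split.
  move=> /(_ _ (basis_wnull (y := y))) Tb0.
  have h2 : 0 < 2^-1 :> R by lra.
  have [N /(_ N (leqnn _))] := Tb0 _ h2; rewrite subr0 /= Tn halfXS.
  by have := halfX_le1 R N; lra.
move=> [x /ballP x1 /(congr1 (@toR R k)) TxT].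
have Txn : nrm (T x) = nrm T := TxT.
(* |T e_N| = 1 - 2^-(N+1) with |e_N| <= 1. An x attaining the norm would give |T x| >= 1 >= |x|,
   against strictness. *)
have T1 : 1 <= nrm T.
  apply/ler_addgt0Pr => e /halfX_small[N NP].
  have := nrm_opP T (basis y N); rewrite Tn; have := NP N.+1 (leqnSn _).
  have : nrm T * nrm (basis y N) <= nrm T by rewrite ler_piMr ?nrm_ge0// basis_nrm.
  lra.
have [x0|/Tx] := eqVneq x 0.
  by move: Txn; rewrite x0 bop0 nrm0 => T0; rewrite -T0 in T1; lra.
by rewrite Txn; lra.
Qed.

End converse.

Theorem theorem3p10 (R : realType) (k : scalar_kind)
    (F : completeNormedModType (scalar_field R k)) :
  [<-> (* a *) schur_property F;
       (* b *) forall E : completeNormedModType (scalar_field R k),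
         reflexive_space E -> compact_ops E F = [set: bounded_op E F];
       (* c *) forall E : completeNormedModType (scalar_field R k),
         reflexive_space E -> weakly_oo_compact_ops E F = [set: bounded_op E F];
       (* d *) forall E : completeNormedModType (scalar_field R k),
         reflexive_space E -> completely_continuous_ops E F = [set: bounded_op E F];
       (* e *) forall E : completeNormedModType (scalar_field R k),
         reflexive_space E -> norm_attaining_ops E F = [set: bounded_op E F];
       (* f *) forall G : completeNormedModType (scalar_field R k),
         reflexive_space G -> has_schauder_basis G ->
         compact_ops G F = [set: bounded_op G F];
       (* g *) forall G : completeNormedModType (scalar_field R k),
         reflexive_space G -> has_schauder_basis G ->
         norm_attaining_ops G F = [set: bounded_op G F];
       (* h *) forall G : completeNormedModType (scalar_field R k),
         reflexive_space G -> has_schauder_basis G ->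
         weakly_oo_compact_ops G F = [set: bounded_op G F];
       (* i *) forall G : completeNormedModType (scalar_field R k),
         reflexive_space G -> has_schauder_basis G ->
         completely_continuous_ops G F = [set: bounded_op G F]].
Proof.
have all_ops (E : completeNormedModType (scalar_field R k)) (A : set (bounded_op E F)) :
    (forall T, A T) -> A = setT.
  by move=> h; apply/seteqP; split=> // T _; exact: h.
have in_all (E : completeNormedModType (scalar_field R k)) (A :
  set (bounded_op E F)) T :
    A = setT -> A T by move=> ->.
(* The implications from (e) to (f) and from (g) to (h) pass through (a) by this fact. *)
have NA_schur : (forall G : completeNormedModType (scalar_field R k),
    reflexive_space G -> has_schauder_basis G ->
    norm_attaining_ops G F = [set: bounded_op G F]) -> schur_property F.
  move=> h; apply: contrapT => /schur_counterexample[G [rG bG [T [_ nT]]]].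
  by apply: nT; apply: in_all; exact: h.
tfae.
- move=> sF E rE; apply: all_ops => T; by apply: ccont_compact => //;
  exact: schur_ccont.
- move=> h E rE; apply: all_ops => T; apply: compact_weakly_oo_compact.
  by apply: in_all; exact: h.
- move=> h E rE; apply: all_ops => T.
  by apply/ccontP/weakly_oo_compact_ccont; apply: in_all; exact: h.
- move=> h E rE; apply: all_ops => T; apply: ccont_norm_attaining => //.
  by apply/ccontP; apply: in_all; exact: h.
- move=> h G rG bG; apply: all_ops => T; apply: ccont_compact => //.
  by apply/schur_ccont/NA_schur => E rE _; exact: h.
- move=> h G rG bG; apply: all_ops => T; apply: ccont_norm_attaining => //.
  apply/weakly_oo_compact_ccont/compact_weakly_oo_compact.
  by apply: in_all; exact: h.
- move=> /NA_schur sF G rG bG; apply: all_ops => T.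
  by apply/compact_weakly_oo_compact/ccont_compact => //; exact: schur_ccont.
- move=> h G rG bG; apply: all_ops => T.
  by apply/ccontP/weakly_oo_compact_ccont; apply: in_all; exact: h.
- move=> h; apply: contrapT => /schur_counterexample[G [rG bG [T [nT _]]]].
  by apply/nT/ccontP; apply: in_all; exact: h.
Qed.
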